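(* Let $\kappa\in\mathbb R$, let $(M,d)$ be a $\mathrm{CAT}(\kappa)$ space and let $C\subseteq M$ be a convex domain. For every integer $n\ge1$, the barycenter map $\hat B_n:C^n\to C$ is $L/n$-Lipschitz with respect to the $\ell^1$-product distance $d_1^{(n)}$, i.e. $$d\big(\hat B_n(x_1,\dots,x_n),\hat B_n(y_1,\dots,y_n)\big)\le \frac{L}{n}\sum_{i=1}^n d(x_i,y_i)\quad\forall x_i,y_i\in C,$$ where $L=1$ if $\kappa\le0$, and $L=2/(\varepsilon^{1/4}\kappa^{1/8})$ if $\kappa>0$, with $\varepsilon>0$ such that $C$ is contained in a closed ball of radius $\frac12(D_\kappa/2-\varepsilon)$.
   Context: $D_\kappa=\infty$ if $\kappa\le0$, $D_\kappa=\pi/\sqrt\kappa$ if $\kappa>0$. A $\mathrm{CAT}(\kappa)$ space is a complete geodesic metric space whose geodesic triangles of perimeter $<2D_\kappa$ are no fatter than their comparison triangles in the model plane $M_\kappa$ of constant curvature $\kappa$ (distances between points on the triangle are at most the distances between corresponding points of the comparison triangle). A convex domain is: any closed geodesically convex subset if $\kappa\le 0$; any closed geodesically convex subset contained in a closed ball of radius $<D_\kappa/4$ if $\kappa>0$. For $x_1,\dots,x_n\in C$, the measure $\frac1n\sum_i\delta_{x_i}$ has a unique barycenter (minimizer of $b\mapsto\frac1n\sum_i d(x_i,b)^2$), which lies in $C$; it is denoted $\hat B_n(x_1,\dots,x_n)$. The distance $d_1^{(n)}$ on $M^n$ is $d_1^{(n)}((x_i),(y_i))=\sum_{i=1}^n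 d(x_i,y_i)$. *)

(* Defs.v *)
From Stdlib Require Import Reals List.
Open Scope R_scope.

Definition is_metric {M : Type} (d : M -> M -> R) : Prop :=
  (forall x y, 0 <= d x y) /\
  (forall x y, d x y = 0 <-> x = y) /\
  (forall x y, d x y = d y x) /\
  (forall x y z, d x z <= d x y + d y z).

Definition cauchy_seq {M : Type} (d : M -> M -> R) (u : nat -> M) : Prop :=
  forall e, 0 < e -> exists N, forall m k, (N <= m)%nat -> (N <= k)%nat -> d (u m) (u k) < e.

Definition converges_to {M : Type} (d : M -> M -> R) (u : nat -> M) (l : M) : Prop :=
  forall e, 0 < e -> exists N, forall m, (N <= m)%nat -> d (u m) l < e.

Definition complete {M : Type} (d : M -> M -> R) : Prop :=
  forall u, cauchy_seq d u -> exists l, converges_to d u l.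

Definition geodesic_segment {M : Type} (d : M -> M -> R) (x y : M) (g : R -> M) : Prop :=
  g 0 = x /\ g (d x y) = y /\
  (forall s t, 0 <= s <= d x y -> 0 <= t <= d x y -> d (g s) (g t) = Rabs (s - t)).

Definition geodesic_space {M : Type} (d : M -> M -> R) : Prop :=
  forall x y, exists g, geodesic_segment d x y g.

(** Model plane M_kappa, realised in R^3:
    kappa = 0 : the plane z = 0 with the Euclidean distance;
    kappa > 0 : the sphere of radius 1/sqrt kappa with the angular (great-circle) distance;
    kappa < 0 : the upper sheet of the hyperboloid x^2+y^2-z^2 = 1/kappa with the
                hyperbolic distance (hyperboloid model). *)
Definition pt3 := (R * R * R)%type.

Definition dot3 (P Q : pt3) : R :=
  let '(x, y, z) := P in let '(x', y', z') := Q in x * x' + y * y' + z * z'.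

Definition lor3 (P Q : pt3) : R :=
  let '(x, y, z) := P in let '(x', y', z') := Q in x * x' + y * y' - z * z'.

Definition on_model (k : R) (P : pt3) : Prop :=
  let '(x, y, z) := P in
  (k = 0 /\ z = 0) \/
  (0 < k /\ dot3 P P = 1 / k) \/
  (k < 0 /\ lor3 P P = 1 / k /\ 0 < z).

Definition arcosh (t : R) : R := ln (t + sqrt (t * t - 1)).

Definition dk (k : R) (P Q : pt3) : R :=
  if Req_EM_T k 0 then
    (let '(x, y, z) := P in let '(x', y', z') := Q in
     sqrt ((x - x') ^ 2 + (y - y') ^ 2 + (z - z') ^ 2))
  else if Rlt_dec 0 k then acos (k * dot3 P Q) / sqrt k
  else arcosh (k * lor3 P Q) / sqrt (- k).

(** D_kappa: perimeter condition "p < 2 D_kappa" (D_kappa = +infinity if kappa <= 0). *)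
Definition below_2Dk (k p : R) : Prop := k <= 0 \/ p < 2 * (PI / sqrt k).

(** x = g s lies on the side [a,b] (parametrised by the geodesic g), and X is the
    corresponding point on the comparison side [A,B] in M_kappa, i.e. the point of
    the model segment [A,B] at distance s from A. *)
Definition corr_pt (k : R) {M : Type} (d : M -> M -> R)
  (a b : M) (g : R -> M) (A B : pt3) (x : M) (X : pt3) : Prop :=
  exists s, 0 <= s <= d a b /\ x = g s /\
    on_model k X /\ dk k A X = s /\ dk k X B = d a b - s.

Definition CAT (k : R) (M : Type) (d : M -> M -> R) : Prop :=
  is_metric d /\ complete d /\ geodesic_space d /\
  forall (p q r : M) (g1 g2 g3 : R -> M) (P Q Rr : pt3),
    geodesic_segment d p q g1 -> geodesic_segment d q r g2 -> geodesic_segment d r p g3 ->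
    below_2Dk k (d p q + d q r + d r p) ->
    on_model k P -> on_model k Q -> on_model k Rr ->
    dk k P Q = d p q -> dk k Q Rr = d q r -> dk k Rr P = d r p ->
    let on_tri x X :=
      corr_pt k d p q g1 P Q x X \/ corr_pt k d q r g2 Q Rr x X \/
      corr_pt k d r p g3 Rr P x X in
    forall x X y Y, on_tri x X -> on_tri y Y -> d x y <= dk k X Y.

Definition closed_set {M : Type} (d : M -> M -> R) (C : M -> Prop) : Prop :=
  forall u l, (forall m, C (u m)) -> converges_to d u l -> C l.

Definition geod_convex {M : Type} (d : M -> M -> R) (C : M -> Prop) : Prop :=
  forall x y g, C x -> C y -> geodesic_segment d x y g ->
    forall t, 0 <= t <= d x y -> C (g t).

Definition in_closed_ball {M : Type} (d : M -> M -> R) (C : M -> Prop) (o : M) (r : R) : Prop :=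
  forall z, C z -> d o z <= r.

Definition convex_domain (k : R) {M : Type} (d : M -> M -> R) (C : M -> Prop) : Prop :=
  closed_set d C /\ geod_convex d C /\
  (0 < k -> exists o r, r < (PI / sqrt k) / 4 /\ in_closed_ball d C o r).

Definition sumR (n : nat) (f : nat -> R) : R := fold_right Rplus 0 (map f (seq 0 n)).

Definition is_barycenter {M : Type} (d : M -> M -> R) (n : nat) (x : nat -> M) (b : M) : Prop :=
  forall c, / INR n * sumR n (fun i => d (x i) b ^ 2) <= / INR n * sumR n (fun i => d (x i) c ^ 2).

(* Main.v *)
From Coquelicot Require Import Coquelicot.
Require Import Defs.
From Stdlib Require Import Reals ZArith List Lra Lia Psatz Classical.
Open Scope R_scope.

(** If the distance satisfies the Bruhat-Tits (CN) inequality, a barycenter [b] satisfies the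
    variance inequality [sum d(x_i,z)^2 - sum d(x_i,b)^2 >= n d(b,z)^2].  Applying it to both
    barycenters and adding, the claim follows from the quadrilateral inequality
    [d(x,b')^2 + d(y,b)^2 - d(x,b)^2 - d(y,b')^2 <= 2 d(x,y) d(b,b')].

    For [k > 0] rescale to [k = 1]; all points lie in a ball of radius [rho < PI/4] about [o].
    The squared distance is a convex function of its cosine with slope [-w/2], [w = r / sin r],
    so minimality of [b] says that [Phi = sum_i w_i cos d(x_i,.)], [w_i = w(d(x_i,b))], has
    nonpositive slope at [b], whence [Phi(z) <= cos d(b,z) Phi(b)].  For [z = o] this gives
    [Phi(b) >= n cos rho], and then the variance inequality with [n d(b,z)^2] replaced by
    [2 n cos rho (1 - cos d(b,z))].  The quadrilateral inequality acquires the factor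
    [w(2 rho)].  The resulting constant stays bounded as [rho] tends to [PI/4], hence is
    below [2 / eps^(1/4)]. *)

(** * Trigonometric and hyperbolic estimates *)

Lemma nonneg_derive_le (f f' : R -> R) (a b : R) :
  a <= b -> (forall c, a <= c <= b -> is_derive f c (f' c)) ->
  (forall c, a <= c <= b -> 0 <= f' c) -> f a <= f b.
Proof.
  intros [Hab | ->] Hd Hp; [|lra].
  destruct (MVT_cor2 f f' a b Hab) as [c [Hc Hac]].
  { intros c Hc. apply is_derive_Reals, Hd, Hc. }
  assert (0 <= f' c) by (apply Hp; lra). nra.
Qed.

Lemma sin_nonneg_halfpi (x : R) : 0 <= x <= PI / 2 -> 0 <= sin x.
Proof. intros H; apply sin_ge_0; lra. Qed.

Lemma cos_nonneg_halfpi (x : R) : 0 <= x <= PI / 2 -> 0 <= cos x.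
Proof. intros H; apply cos_ge_0; lra. Qed.

Lemma cos_le_decr (x y : R) : 0 <= x -> x <= y -> y <= PI -> cos y <= cos x.
Proof. intros; apply cos_decr_1; lra. Qed.

Lemma le_of_cos_le (x y : R) : 0 <= x <= PI -> 0 <= y <= PI -> cos y <= cos x -> x <= y.
Proof. intros; apply cos_decr_0; lra. Qed.

Lemma sin_le_self (x : R) : 0 <= x -> sin x <= x.
Proof. intros [H | <-]; [left; apply sin_lt_x, H | rewrite sin_0; lra]. Qed.

Lemma cos_ge_taylor2 (x : R) : 1 - x ^ 2 / 2 <= cos x.
Proof.
  enough (H : forall t, 0 <= t -> 1 - t ^ 2 / 2 <= cos t).
  { destruct (Rle_dec 0 x); [now apply H|].
    rewrite <- cos_neg. specialize (H (- x)). lra. }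
  clear x; intros x Hx.
  assert (H := nonneg_derive_le (fun t => cos t + t ^ 2 / 2) (fun t => t - sin t) 0 x Hx).
  cbv beta in H. rewrite cos_0 in H.
  enough (1 + 0 ^ 2 / 2 <= cos x + x ^ 2 / 2) by lra.
  apply H; intros c Hc; [auto_derive; [easy|simpl; lra]|].
  assert (H' := sin_le_self c). lra.
Qed.

Lemma sin_ge_taylor3 (x : R) : 0 <= x -> x - x ^ 3 / 6 <= sin x.
Proof.
  intros Hx.
  assert (H := nonneg_derive_le (fun t => sin t - t + t ^ 3 / 6)
                 (fun t => cos t - (1 - t ^ 2 / 2)) 0 x Hx).
  cbv beta in H. rewrite sin_0 in H.
  enough (0 - 0 + 0 ^ 3 / 6 <= sin x - x + x ^ 3 / 6) by lra.
  apply H; intros c Hc; [auto_derive; [easy|simpl; lra]|].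
  assert (H' := cos_ge_taylor2 c). lra.
Qed.

Lemma cos_le_taylor4 (x : R) : cos x <= 1 - x ^ 2 / 2 + x ^ 4 / 24.
Proof.
  enough (H : forall t, 0 <= t -> cos t <= 1 - t ^ 2 / 2 + t ^ 4 / 24).
  { destruct (Rle_dec 0 x); [now apply H|].
    rewrite <- cos_neg. specialize (H (- x)).
    replace ((- x) ^ 2) with (x ^ 2) in H by ring.
    replace ((- x) ^ 4) with (x ^ 4) in H by ring. lra. }
  clear x; intros x Hx.
  assert (H := nonneg_derive_le (fun t => - cos t - t ^ 2 / 2 + t ^ 4 / 24)
                 (fun t => sin t - (t - t ^ 3 / 6)) 0 x Hx).
  cbv beta in H. rewrite cos_0 in H.
  enough (- 1 - 0 ^ 2 / 2 + 0 ^ 4 / 24 <= - cos x - x ^ 2 / 2 + x ^ 4 / 24) by lra.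
  apply H; intros c Hc; [auto_derive; [easy|simpl; lra]|].
  assert (H' := sin_ge_taylor3 c). lra.
Qed.

(** Otherwise [1.6 < PI / 2] and [cos 1.6 > 0], while the quartic Taylor bound is negative at
    [1.6]. *)
Lemma PI_le_3_2 : PI <= 3.2.
Proof.
  destruct (Rle_dec PI 3.2) as [|H]; [easy|exfalso].
  assert (0 < cos 1.6) by (apply cos_gt_0; lra).
  assert (H' := cos_le_taylor4 1.6). lra.
Qed.

Lemma cos_lipschitz (x y : R) : Rabs (cos x - cos y) <= Rabs (x - y).
Proof.
  enough (H : forall u v, u <= v -> Rabs (cos u - cos v) <= v - u).
  { destruct (Rle_dec x y) as [h | h].
    - rewrite (Rabs_left1 (x - y)) by lra. specialize (H x y h); lra.
    - rewrite (Rabs_right (x - y)) by lra. rewrite Rabs_minus_sym.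
      apply H; lra. }
  intros u v Huv.
  assert (H1 := nonneg_derive_le (fun t => cos t + t) (fun t => 1 - sin t) u v Huv).
  assert (H2 := nonneg_derive_le (fun t => t - cos t) (fun t => 1 + sin t) u v Huv).
  cbv beta in *. apply Rabs_le. split.
  - enough (u - cos u <= v - cos v) by lra.
    apply H2; intros c Hc; [auto_derive; [easy|simpl; lra]|].
    destruct (SIN_bound c); lra.
  - enough (cos u + u <= cos v + v) by lra.
    apply H1; intros c Hc; [auto_derive; [easy|simpl; lra]|].
    destruct (SIN_bound c); lra.
Qed.

(** The second derivative of the cosine is bounded by 1; this enters in the form that [sin], a
    shifted cosine, is 1-Lipschitz. *)
Lemma cos_le_taylor2_at (a x : R) :
  cos x <= cos a - sin a * (x - a) + (x - a) ^ 2 / 2.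
Proof.
  replace x with (a + (x - a)) at 1 by ring. set (t := x - a).
  enough (H : forall a t, 0 <= t -> cos (a + t) <= cos a - sin a * t + t ^ 2 / 2).
  { destruct (Rle_dec 0 t); [now apply H|].
    specialize (H (- a) (- t)). rewrite <- Ropp_plus_distr, !cos_neg, sin_neg in H.
    lra. }
  clear; intros a t Ht.
  assert (H := nonneg_derive_le (fun s => cos a - sin a * s + s ^ 2 / 2 - cos (a + s))
    (fun s => s - (sin a - sin (a + s))) 0 t Ht). cbv beta in H.
  rewrite Rplus_0_r in H.
  enough (cos a - sin a * 0 + 0 ^ 2 / 2 - cos a
     <= cos a - sin a * t + t ^ 2 / 2 - cos (a + t)) by lra.
  apply H; intros c Hc; [auto_derive; [easy|simpl; lra]|].
  assert (Hl := cos_lipschitz (PI / 2 - a) (PI / 2 - (a + c))).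
  rewrite !cos_shift in Hl.
  replace (PI / 2 - a - (PI / 2 - (a + c))) with c in Hl by ring.
  rewrite (Rabs_right c) in Hl by lra.
  assert (Hr := Rle_abs (sin a - sin (a + c))). lra.
Qed.

Lemma mul_cos_le_sin (x : R) : 0 <= x <= PI / 2 -> x * cos x <= sin x.
Proof.
  intros Hx.
  assert (H := nonneg_derive_le (fun t => sin t - t * cos t) (fun t => t * sin t) 0 x (proj1 Hx)).
  cbv beta in H. rewrite sin_0 in H.
  enough (0 - 0 * cos 0 <= sin x - x * cos x) by lra.
  apply H; intros c Hc; [auto_derive; [easy|simpl; lra]|].
  assert (0 <= sin c) by (apply sin_nonneg_halfpi; lra). nra.
Qed.

Lemma sin_ratio_decr (x y : R) : 0 <= x -> x <= y -> y <= PI / 2 -> x * sin y <= y * sin x.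
Proof.
  intros Hx Hxy Hy.
  assert (H := nonneg_derive_le (fun t => t * sin x - x * sin t)
                 (fun t => sin x - x * cos t) x y Hxy).
  cbv beta in H.
  enough (x * sin x - x * sin x <= y * sin x - x * sin y) by lra.
  apply H; intros c Hc; [auto_derive; [easy|simpl; lra]|].
  assert (H1 := mul_cos_le_sin x). assert (cos c <= cos x) by (apply cos_le_decr; lra). nra.
Qed.

(** Minus the derivative of [x ^ 2 / 2] with respect to [cos x]. The value at 0 is the limit there,
    which keeps the function monotone on [[0, PI / 2]]. *)
Definition inv_sinc (x : R) : R := if Req_EM_T x 0 then 1 else x / sin x.

Lemma inv_sinc_sin (x : R) : 0 <= x <= PI / 2 -> inv_sinc x * sin x = x.
Proof.
  intros Hx. unfold inv_sinc. destruct (Req_EM_T x 0) as [-> | Hn].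
  - rewrite sin_0; ring.
  - assert (0 < sin x) by (apply sin_gt_0; lra). field; lra.
Qed.

Lemma inv_sinc_ge_1 (x : R) : 0 <= x <= PI / 2 -> 1 <= inv_sinc x.
Proof.
  intros Hx. unfold inv_sinc. destruct (Req_EM_T x 0) as [-> | Hn]; [lra|].
  assert (0 < sin x) by (apply sin_gt_0; lra).
  apply Rmult_le_reg_r with (sin x); [easy|].
  replace (x / sin x * sin x) with x by (field; lra).
  assert (H' := sin_le_self x). lra.
Qed.

Lemma inv_sinc_incr (x y : R) : 0 <= x -> x <= y -> y <= PI / 2 -> inv_sinc x <= inv_sinc y.
Proof.
  intros Hx Hxy Hy.
  assert (Hy1 : 1 <= inv_sinc y) by (apply inv_sinc_ge_1; lra).
  destruct (Req_EM_T x 0) as [-> | Hn].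
  - unfold inv_sinc at 1. destruct (Req_EM_T 0 0); lra.
  - assert (Hsx : 0 < sin x) by (apply sin_gt_0; lra).
    assert (Hsy : 0 < sin y) by (apply sin_gt_0; lra).
    assert (Ex := inv_sinc_sin x). assert (Ey := inv_sinc_sin y).
    assert (Hr := sin_ratio_decr x y Hx Hxy Hy).
    apply Rmult_le_reg_r with (sin x * sin y); [nra|].
    replace (inv_sinc x * (sin x * sin y)) with ((inv_sinc x * sin x) * sin y) by ring.
    replace (inv_sinc y * (sin x * sin y)) with ((inv_sinc y * sin y) * sin x) by ring.
    rewrite Ex, Ey by lra. lra.
Qed.

(** The bound [x cot x <= 1]; it lets second-order terms cancel in the cell estimate for curvature
    1. *)
Lemma inv_sinc_mul_cos_le_1 (x : R) : 0 <= x <= PI / 2 -> inv_sinc x * cos x <= 1.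
Proof.
  intros Hx. unfold inv_sinc. destruct (Req_EM_T x 0) as [-> | Hn].
  - rewrite cos_0; lra.
  - assert (0 < sin x) by (apply sin_gt_0; lra).
    apply Rmult_le_reg_r with (sin x); [easy|].
    replace (x / sin x * cos x * sin x) with (x * cos x) by (field; lra).
    assert (H' := mul_cos_le_sin x Hx). lra.
Qed.

(* [x^2 / 2] is a convex function of [cos x], with slope [- x / sin x]. *)
Lemma sqr_convex_in_cos (a x : R) :
  0 <= a <= PI / 2 -> 0 <= x <= PI / 2 ->
  inv_sinc a * (cos a - cos x) <= x ^ 2 / 2 - a ^ 2 / 2.
Proof.
  intros Ha Hx. set (w := inv_sinc a).
  assert (Hw : 1 <= w) by now apply inv_sinc_ge_1.
  destruct (Rle_dec a x) as [H | H].
  - assert (G := nonneg_derive_le (fun t => t ^ 2 / 2 + w * cos t)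
                   (fun t => t - w * sin t) a x H). cbv beta in G.
    enough (a ^ 2 / 2 + w * cos a <= x ^ 2 / 2 + w * cos x) by lra.
    apply G; intros c Hc; [auto_derive; [easy|simpl; lra]|].
    assert (Hi : w <= inv_sinc c) by (apply inv_sinc_incr; lra).
    assert (0 <= sin c) by (apply sin_nonneg_halfpi; lra).
    rewrite <- (inv_sinc_sin c) at 1 by lra. nra.
  - assert (Hxa : x <= a) by lra.
    assert (G := nonneg_derive_le (fun t => - (t ^ 2 / 2) - w * cos t)
                   (fun t => w * sin t - t) x a Hxa). cbv beta in G.
    enough (- (x ^ 2 / 2) - w * cos x <= - (a ^ 2 / 2) - w * cos a) by lra.
    apply G; intros c Hc; [auto_derive; [easy|simpl; lra]|].
    assert (Hi : inv_sinc c <= w) by (apply inv_sinc_incr; lra).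
    assert (0 <= sin c) by (apply sin_nonneg_halfpi; lra).
    rewrite <- (inv_sinc_sin c) at 2 by lra. nra.
Qed.

(** A converse of the convexity inequality, up to a quadratic error. Multiplying the Taylor bound of
    [cos] at [a] by [inv_sinc a] turns its linear coefficient into [a], because
    [inv_sinc a * sin a = a]. *)
Lemma sqr_le_taylor_in_cos (a x : R) :
  0 <= a <= PI / 2 ->
  x ^ 2 / 2 - a ^ 2 / 2 <= inv_sinc a * (cos a - cos x) + (1 + inv_sinc a) / 2 * (x - a) ^ 2.
Proof.
  intros Ha. assert (H := cos_le_taylor2_at a x).
  assert (Hw := inv_sinc_ge_1 a Ha). assert (E := inv_sinc_sin a Ha).
  set (w := inv_sinc a) in *.
  assert (w * cos x <= w * (cos a - sin a * (x - a) + (x - a) ^ 2 / 2))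
    by (apply Rmult_le_compat_l; lra).
  replace (w * (cos a - sin a * (x - a) + (x - a) ^ 2 / 2)) with
    (w * cos a - (w * sin a) * (x - a) + w * (x - a) ^ 2 / 2) in H0 by field.
  rewrite E in H0.
  replace (x ^ 2 / 2 - a ^ 2 / 2) with (a * (x - a) + (x - a) ^ 2 / 2) by field. lra.
Qed.

(** * Hyperbolic functions *)

Lemma cosh_pos (x : R) : 0 < cosh x.
Proof. unfold cosh. assert (H := exp_pos x). assert (H' := exp_pos (- x)). lra. Qed.

Lemma cosh_0 : cosh 0 = 1.
Proof. unfold cosh; rewrite Ropp_0, exp_0; lra. Qed.

Lemma cosh_sqr (x : R) : cosh x ^ 2 = 1 + sinh x ^ 2.
Proof.
  unfold cosh, sinh.
  assert (H : exp x * exp (- x) = 1)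
    by (rewrite <- exp_plus; replace (x + - x) with 0 by ring; apply exp_0).
  nra.
Qed.

Lemma cosh_plus_minus (u v : R) : cosh (u + v) + cosh (u - v) = 2 * (cosh u * cosh v).
Proof.
  unfold cosh. replace (- (u + v)) with (- u + - v) by ring.
  replace (- (u - v)) with (- u + v) by ring. unfold Rminus. rewrite !exp_plus. field.
Qed.

Lemma cosh_minus_plus (u v : R) : cosh (u + v) - cosh (u - v) = 2 * (sinh u * sinh v).
Proof.
  unfold cosh, sinh. replace (- (u + v)) with (- u + - v) by ring.
  replace (- (u - v)) with (- u + v) by ring. unfold Rminus. rewrite !exp_plus. field.
Qed.

Lemma cosh_even (x : R) : cosh (- x) = cosh x.
Proof. unfold cosh. rewrite Ropp_involutive. lra. Qed.

Lemma is_derive_cosh (x : R) : is_derive cosh x (sinh x).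
Proof. unfold cosh, sinh. auto_derive; [easy|lra]. Qed.

Lemma is_derive_sinh (x : R) : is_derive sinh x (cosh x).
Proof. unfold cosh, sinh. auto_derive; [easy|lra]. Qed.

Lemma sinh_nonneg (x : R) : 0 <= x -> 0 <= sinh x.
Proof.
  intros Hx. rewrite <- sinh_0.
  apply (nonneg_derive_le sinh cosh 0 x Hx).
  - intros; apply is_derive_sinh.
  - intros; left; apply cosh_pos.
Qed.

Lemma cosh_le (x y : R) : 0 <= x <= y -> cosh x <= cosh y.
Proof.
  intros [Hx Hy]. apply (nonneg_derive_le cosh sinh x y Hy).
  - intros; apply is_derive_cosh.
  - intros; apply sinh_nonneg; lra.
Qed.

Lemma sinh_le_mul_cosh (x : R) : 0 <= x -> sinh x <= x * cosh x.
Proof.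
  intros Hx.
  assert (H := nonneg_derive_le (fun t => t * cosh t - sinh t) (fun t => t * sinh t) 0 x Hx).
  cbv beta in H. rewrite sinh_0 in H.
  enough (0 * cosh 0 - 0 <= x * cosh x - sinh x) by lra.
  apply H; intros c Hc.
  - unfold cosh, sinh. auto_derive; [easy|lra].
  - assert (H0 := sinh_nonneg c). nra.
Qed.

Lemma sinh_ratio_incr (x y : R) : 0 <= x <= y -> y * sinh x <= x * sinh y.
Proof.
  intros [Hx Hy].
  assert (H := nonneg_derive_le (fun t => x * sinh t - t * sinh x)
                 (fun t => x * cosh t - sinh x) x y Hy). cbv beta in H.
  enough (x * sinh x - x * sinh x <= x * sinh y - y * sinh x) by lra.
  apply H; intros c Hc.
  - unfold cosh, sinh. auto_derive; [easy|lra].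
  - assert (H1 := sinh_le_mul_cosh x Hx). assert (cosh x <= cosh c) by (apply cosh_le; lra). nra.
Qed.

(* [cosh x] is a convex function of [x^2], with slope [sinh x / (2 x)]. *)
Lemma cosh_convex_in_sqr (a x : R) :
  0 < a -> 0 <= x -> sinh a * (x ^ 2 - a ^ 2) <= 2 * a * (cosh x - cosh a).
Proof.
  intros Ha Hx.
  destruct (Rle_dec a x) as [H | H].
  - assert (G := nonneg_derive_le (fun t => 2 * a * cosh t - sinh a * t ^ 2)
                   (fun t => 2 * (a * sinh t - t * sinh a)) a x H). cbv beta in G.
    enough (2 * a * cosh a - sinh a * a ^ 2 <= 2 * a * cosh x - sinh a * x ^ 2) by lra.
    apply G; intros c Hc.
    + unfold cosh, sinh. auto_derive; [easy|simpl; lra].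
    + assert (H' := sinh_ratio_incr a c). lra.
  - assert (Hxa : x <= a) by lra.
    assert (G := nonneg_derive_le (fun t => sinh a * t ^ 2 - 2 * a * cosh t)
                   (fun t => 2 * (t * sinh a - a * sinh t)) x a Hxa). cbv beta in G.
    enough (sinh a * x ^ 2 - 2 * a * cosh x <= sinh a * a ^ 2 - 2 * a * cosh a) by lra.
    apply G; intros c Hc.
    + unfold cosh, sinh. auto_derive; [easy|simpl; lra].
    + assert (H' := sinh_ratio_incr c a). lra.
Qed.

(** Karamata's inequality for two points: the pair of squares [a1 ^ 2, b1 ^ 2] majorizes
    [a ^ 2, b ^ 2], and [cosh] is convex in the square. Tangents are taken at [a] and [b], so
    [b = 0] is treated apart. *)
Lemma cosh_sum_le (a b a1 b1 : R) :
  0 <= b1 -> b1 <= b -> b <= a -> a <= a1 -> a ^ 2 + b ^ 2 = a1 ^ 2 + b1 ^ 2 ->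
  cosh a + cosh b <= cosh a1 + cosh b1.
Proof.
  intros H1 H2 H3 H4 E.
  destruct (Req_dec b 0) as [-> | Hb].
  { assert (b1 = 0) by lra. subst b1.
    assert (cosh a <= cosh a1) by (apply cosh_le; lra). lra. }
  assert (Ta := cosh_convex_in_sqr a a1). assert (Tb := cosh_convex_in_sqr b b1).
  assert (S := sinh_ratio_incr b a).
  assert (A1 : sinh a * (a1 ^ 2 - a ^ 2) <= 2 * a * (cosh a1 - cosh a)) by (apply Ta; lra).
  assert (B1 : sinh b * (b1 ^ 2 - b ^ 2) <= 2 * b * (cosh b1 - cosh b)) by (apply Tb; lra).
  assert (S' : a * sinh b <= b * sinh a) by (apply S; lra).
  replace (b1 ^ 2 - b ^ 2) with (- (a1 ^ 2 - a ^ 2)) in B1 by lra.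
  set (t := a1 ^ 2 - a ^ 2) in *.
  assert (0 <= t) by (unfold t; nra).
  apply Rmult_le_reg_l with (2 * a * b); [nra|].
  assert (b * (sinh a * t) <= b * (2 * a * (cosh a1 - cosh a))) by (apply Rmult_le_compat_l; lra).
  assert (a * (sinh b * - t) <= a * (2 * b * (cosh b1 - cosh b))) by (apply Rmult_le_compat_l; lra).
  assert (a * sinh b * t <= b * sinh a * t) by (apply Rmult_le_compat_r; lra).
  lra.
Qed.

(** Products become sums of [cosh] at [u + v, u - v] and at [n + h, n - h]. Both pairs have the same
    sum of squares, and [u * v <= n * h] because [h] lies between [v] and [u], so the second pair is
    more spread out. The lemma says that a hyperbolic median is at most the Euclidean one. *)
Lemma cosh_mul_le (u v h n : R) :
  0 <= v -> v <= h -> h <= u -> 0 <= n -> n ^ 2 + h ^ 2 = u ^ 2 + v ^ 2 ->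
  cosh u * cosh v <= cosh n * cosh h.
Proof.
  intros Hv Hvh Hhu Hn E.
  assert (Hnv : v <= n) by nra. assert (Hnu : n <= u) by nra.
  assert (Huv : u * v <= n * h).
  { assert (0 <= (u ^ 2 - h ^ 2) * (h ^ 2 - v ^ 2)) by (apply Rmult_le_pos; nra).
    assert ((u * v) ^ 2 <= (n * h) ^ 2).
    { replace ((n * h) ^ 2) with ((u ^ 2 + v ^ 2 - h ^ 2) * h ^ 2)
        by (rewrite <- E; ring). nra. }
    apply Rsqr_incr_0_var; unfold Rsqr; nra. }
  enough (cosh (u + v) + cosh (u - v) <= cosh (n + h) + cosh (n - h)).
  { rewrite !cosh_plus_minus in H. lra. }
  (* The sign of [n - h] is unknown, so [m] stands for its absolute value. *)
  assert (Habs : exists m, 0 <= m /\ m ^ 2 = (n - h) ^ 2 /\ cosh (n - h) = cosh m).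
  { destruct (Rle_dec 0 (n - h)).
    - exists (n - h); repeat split; lra.
    - exists (- (n - h)); split; [lra|]; split; [ring|]. now rewrite cosh_even. }
  destruct Habs as [m [Hm [Em ->]]].
  apply cosh_sum_le; nra.
Qed.

(** * Finite sums, mixed differences and the CN inequality *)

Lemma sumR_0 (f : nat -> R) : sumR 0 f = 0.
Proof. reflexivity. Qed.

Lemma sumR_S (n : nat) (f : nat -> R) : sumR (S n) f = sumR n f + f n.
Proof.
  unfold sumR. rewrite seq_S, map_app, fold_right_app. simpl.
  rewrite Rplus_0_r.
  generalize (map f (seq 0 n)) as l. induction l as [|a l IH]; simpl; [lra|].
  rewrite IH; lra.
Qed.

Lemma sumR_le (n : nat) (f g : nat -> R) :
  (forall i, (i < n)%nat -> f i <= g i) -> sumR n f <= sumR n g.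
Proof.
  induction n as [|n IH]; intros H; [rewrite !sumR_0; lra|].
  rewrite !sumR_S. assert (f n <= g n) by (apply H; lia).
  assert (sumR n f <= sumR n g) by (apply IH; intros; apply H; lia). lra.
Qed.

Lemma sumR_ext (n : nat) (f g : nat -> R) :
  (forall i, (i < n)%nat -> f i = g i) -> sumR n f = sumR n g.
Proof. intros H; apply Rle_antisym; apply sumR_le; intros i Hi; rewrite H; auto; lra. Qed.

Lemma sumR_lt (n : nat) (f g : nat -> R) :
  (1 <= n)%nat -> (forall i, (i < n)%nat -> f i < g i) -> sumR n f < sumR n g.
Proof.
  intros Hn H. destruct n as [|n]; [lia|]. rewrite !sumR_S.
  assert (f n < g n) by (apply H; lia).
  assert (sumR n f <= sumR n g) by (apply sumR_le; intros; left; apply H; lia). lra.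
Qed.

Lemma sumR_plus (n : nat) (f g : nat -> R) :
  sumR n (fun i => f i + g i) = sumR n f + sumR n g.
Proof.
  induction n as [|n IH]; [rewrite !sumR_0; lra|]. rewrite !sumR_S, IH; lra.
Qed.

Lemma sumR_scal (n : nat) (c : R) (f : nat -> R) :
  sumR n (fun i => c * f i) = c * sumR n f.
Proof.
  induction n as [|n IH]; [rewrite !sumR_0; lra|]. rewrite !sumR_S, IH; lra.
Qed.

Lemma sumR_minus (n : nat) (f g : nat -> R) :
  sumR n (fun i => f i - g i) = sumR n f - sumR n g.
Proof.
  induction n as [|n IH]; [rewrite !sumR_0; lra|]. rewrite !sumR_S, IH; lra.
Qed.

Lemma sumR_const (n : nat) (c : R) : sumR n (fun _ => c) = INR n * c.
Proof.
  induction n as [|n IH]; [rewrite sumR_0; simpl; lra|]. rewrite sumR_S, IH, S_INR; lra.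
Qed.

Definition minimizes {M : Type} (d : M -> M -> R) (n : nat) (x : nat -> M) (b : M) : Prop :=
  forall z, sumR n (fun i => d (x i) b ^ 2) <= sumR n (fun i => d (x i) z ^ 2).

Lemma barycenter_minimizes {M : Type} (d : M -> M -> R) (n : nat) (x : nat -> M) (b : M) :
  (1 <= n)%nat -> is_barycenter d n x b -> minimizes d n x b.
Proof.
  intros Hn H z. specialize (H z).
  assert (0 < / INR n) by (apply Rinv_0_lt_compat, lt_0_INR; lia).
  now apply Rmult_le_reg_l in H.
Qed.

(** The form in which limits [h -> 0] are taken below. *)
Lemma le_of_le_plus_linear (a b c : R) :
  (forall h, 0 < h <= 1 -> a <= b + c * h) -> a <= b.
Proof.
  intros H. destruct (Rle_dec a b) as [|Hn]; [easy|exfalso].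
  assert (Hc : 0 < Rabs c + 1) by (assert (Hp := Rabs_pos c); lra).
  set (h := Rmin 1 ((a - b) / 2 / (Rabs c + 1))).
  assert (Hh : 0 < h).
  { unfold h. apply Rmin_pos; [lra|]. repeat apply Rdiv_lt_0_compat; lra. }
  assert (Hh1 : h <= 1) by apply Rmin_l.
  assert (Hh2 : (Rabs c + 1) * h <= (a - b) / 2).
  { apply Rle_trans with ((Rabs c + 1) * ((a - b) / 2 / (Rabs c + 1))).
    - apply Rmult_le_compat_l; [lra|apply Rmin_r].
    - right; field; lra. }
  specialize (H h (conj Hh Hh1)). assert (Hr := Rle_abs c). nra.
Qed.

(** * Subdivision of geodesics and mixed differences *)

Definition has_geodesics_in {M : Type} (d : M -> M -> R) (S : M -> Prop) : Prop :=
  forall x y, S x -> S y -> exists g, geodesic_segment d x y g /\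
    forall t, 0 <= t <= d x y -> S (g t).

(** Points at spacing [h] on a geodesic. Truncating the parameter at the end point makes the last
    bounds hold for every index, and rounding the number of steps up costs at most one extra [h]. *)
Lemma geodesic_subdivision {M : Type} (d : M -> M -> R) (S : M -> Prop) (x y : M) (h : R) :
  is_metric d -> has_geodesics_in d S -> S x -> S y -> 0 < h ->
  exists (N : nat) (z : nat -> M), z 0%nat = x /\ z N = y /\ INR N * h <= d x y + h /\
    (forall i, S (z i)) /\ (forall i, d (z i) (z (1 + i)%nat) <= h).
Proof.
  intros [Hd _] Hg Sx Sy Hh. destruct (Hg x y Sx Sy) as [g [[G0 [G1 Gd]] Gs]].
  assert (Hxy := Hd x y). clear Hd.
  set (r := d x y) in *.
  assert (Hr : 0 <= r / h) by (apply Rmult_le_pos; [lra|left; now apply Rinv_0_lt_compat]).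
  destruct (archimed (r / h)) as [Hup1 Hup2].
  assert (Hz : (0 <= up (r / h))%Z) by (apply le_IZR; lra).
  assert (HN : INR (Z.to_nat (up (r / h))) = IZR (up (r / h))).
  { rewrite INR_IZR_INZ. now rewrite Z2Nat.id. }
  assert (Er : r / h * h = r) by (field; lra).
  assert (Hcl : forall t, 0 <= t -> 0 <= Rmin t r <= r).
  { intros t Ht. split; [apply Rmin_glb; lra|apply Rmin_r]. }
  assert (Hih : forall i, 0 <= INR i * h) by (intros; apply Rmult_le_pos; [apply pos_INR|lra]).
  exists (Z.to_nat (up (r / h))), (fun i => g (Rmin (INR i * h) r)).
  split; [|split; [|split; [|split]]].
  - simpl. rewrite Rmult_0_l, Rmin_left by lra. exact G0.
  - rewrite HN, Rmin_right by nra. exact G1.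
  - rewrite HN. nra.
  - intros i. apply Gs, Hcl, Hih.
  - intros i. rewrite Gd by apply Hcl, Hih.
    replace (INR (1 + i)) with (INR i + 1) by (rewrite <- S_INR; reflexivity).
    specialize (Hih i).
    unfold Rmin. repeat destruct (Rle_dec _ _); apply Rabs_le; lra.
Qed.

(** For the squared Euclidean distance this is twice the inner product of [y - x] and [b' - b]. *)
Definition mixed_diff {M : Type} (f : M -> M -> R) (x y b b' : M) : R :=
  f x b' + f y b - f x b - f y b'.

(** Telescoping over an [m] by [n] grid of cells, first along each row and then over the rows. *)
Lemma mixed_diff_chain {M : Type} (f : M -> M -> R) (z w : nat -> M) (e : R) :
  (forall i j, mixed_diff f (z i) (z (1 + i)%nat) (w j) (w (1 + j)%nat) <= e) ->
  forall m n, mixed_diff f (z 0%nat) (z m) (w 0%nat) (w n) <= INR m * (INR n * e).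
Proof.
  intros H m n.
  assert (Hrow : forall i, mixed_diff f (z i) (z (1 + i)%nat) (w 0%nat) (w n) <= INR n * e).
  { intros i. induction n as [|n IH].
    - unfold mixed_diff. simpl. lra.
    - rewrite S_INR. specialize (H i n). unfold mixed_diff in *. simpl in *. lra. }
  induction m as [|m IH].
  - unfold mixed_diff. simpl. lra.
  - rewrite S_INR. specialize (Hrow m). unfold mixed_diff in *. simpl in *. lra.
Qed.

(* Mixed differences are additive in both pairs, so an estimate on cells of side [h] with
   relative error [O(h)] gives the sharp product estimate for arbitrary quadrilaterals. *)
Lemma mixed_diff_le_product {M : Type} (d f : M -> M -> R) (S : M -> Prop) (K : R) :
  is_metric d -> has_geodesics_in d S -> 0 <= K ->
  (forall h x y b b', 0 < h <= 1 -> S x -> S y -> S b -> S b' -> d x y <= h -> d b b' <= h ->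
     mixed_diff f x y b b' <= K * (1 + 2 * h) * h ^ 2) ->
  forall x y b b', S x -> S y -> S b -> S b' ->
    mixed_diff f x y b b' <= K * (d x y * d b b').
Proof.
  intros Hm Hg HK Hcell x y b b' Sx Sy Sb Sb'.
  assert (Hp : 0 <= d x y) by apply Hm. assert (Hq : 0 <= d b b') by apply Hm.
  set (p := d x y) in *. set (q := d b b') in *.
  (* The coefficient comes from expanding [(1 + 2 * h) * ((p + h) * (q + h))] and bounding the
     higher powers of [h] by [h]. *)
  apply le_of_le_plus_linear with (K * (3 * (p + q + 1) + 2 * p * q)).
  intros h Hh.
  destruct (geodesic_subdivision d S x y h Hm Hg Sx Sy) as [m [z [Z0 [Z1 [Zn [Zs Zd]]]]]]; [lra|].
  destruct (geodesic_subdivision d S b b' h Hm Hg Sb Sb') as [n [w [W0 [W1 [Wn [Ws Wd]]]]]]; [lra|].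
  assert (H := mixed_diff_chain f z w (K * (1 + 2 * h) * h ^ 2)).
  rewrite <- Z0, <- Z1, <- W0, <- W1.
  apply Rle_trans with (INR m * (INR n * (K * (1 + 2 * h) * h ^ 2))).
  { apply H. intros; apply Hcell; auto. }
  fold p in Zn. fold q in Wn.
  replace (INR m * (INR n * (K * (1 + 2 * h) * h ^ 2)))
    with (K * (1 + 2 * h) * ((INR m * h) * (INR n * h))) by ring.
  assert (0 <= INR m * h) by (apply Rmult_le_pos; [apply pos_INR|lra]).
  assert (0 <= INR n * h) by (apply Rmult_le_pos; [apply pos_INR|lra]).
  assert ((INR m * h) * (INR n * h) <= (p + h) * (q + h)) by (apply Rmult_le_compat; lra).
  apply Rle_trans with (K * (1 + 2 * h) * ((p + h) * (q + h))).
  { apply Rmult_le_compat_l; [apply Rmult_le_pos; lra|easy]. }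
  replace (K * (p * q) + K * (3 * (p + q + 1) + 2 * p * q) * h)
    with (K * (p * q + (3 * (p + q + 1) + 2 * p * q) * h)) by ring.
  rewrite Rmult_assoc. apply Rmult_le_compat_l; [easy|].
  assert (0 <= h * (1 - h)) by nra. assert (0 <= (p + q) * (h * (1 - h))) by nra.
  assert (0 <= h * (h * (1 - h))) by nra. nra.
Qed.

(** The right-hand side is the squared median of the Euclidean triangle with the same side
    lengths. *)
Definition CN_inequality {M : Type} (d : M -> M -> R) : Prop :=
  forall p q r g, geodesic_segment d q r g ->
    d p (g (d q r / 2)) ^ 2 <= (d p q ^ 2 + d p r ^ 2) / 2 - d q r ^ 2 / 4.

(** Only small cells need an estimate. With [m] the midpoint of [x] and [b'], CN bounds [d y m] and
    [d b m], and [d y b ^ 2 <= 2 * (d y m ^ 2 + d b m ^ 2)]. Hence the mixed difference is at most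
    [d x y ^ 2 + d b b' ^ 2], which is at most [2 * h ^ 2]. *)
Lemma CN_quadrilateral {M : Type} (d : M -> M -> R) :
  is_metric d -> geodesic_space d -> CN_inequality d ->
  forall x y b b',
    d x b' ^ 2 + d y b ^ 2 - d x b ^ 2 - d y b' ^ 2 <= 2 * (d x y * d b b').
Proof.
  intros Hm Hg HCN x y b b'.
  apply (mixed_diff_le_product d (fun u v => d u v ^ 2) (fun _ => True) 2 Hm); try exact I; try lra.
  { intros u v _ _. destruct (Hg u v) as [g G]. now exists g. }
  clear x y b b'. intros h x y b b' Hh _ _ _ _ Hxy Hbb. unfold mixed_diff.
  destruct (Hg x b') as [g G].
  assert (H1 := HCN y x b' g G). assert (H2 := HCN b x b' g G).
  set (m := g (d x b' / 2)) in *.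
  destruct Hm as [Pos [_ [Sym Tri]]].
  assert (T := Tri y m b). rewrite (Sym m b) in T. rewrite (Sym y x) in H1. rewrite (Sym b x) in H2.
  assert (0 <= d y b) by apply Pos. assert (0 <= d x y) by apply Pos. assert (0 <= d b b') by apply Pos.
  assert (d y b ^ 2 <= (d y m + d b m) ^ 2) by (apply pow_incr; lra).
  assert (d x y ^ 2 <= h ^ 2) by (apply pow_incr; lra).
  assert (d b b' ^ 2 <= h ^ 2) by (apply pow_incr; lra).
  assert (0 <= (d y m - d b m) ^ 2) by apply pow2_ge_0.
  assert (0 <= h * h ^ 2) by nra. nra.
Qed.

(** Bootstrapping: if the inequality holds for all [z] with a factor [c], then using it at the
    midpoint of [b] and [z] together with CN gives the factor [(1 + c) / 2]. Minimality gives
    [c = 0], and iteration gives [1 - 2 ^ (-k)], which tends to 1. *)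
Lemma CN_variance {M : Type} (d : M -> M -> R) (n : nat) (x : nat -> M) (b : M) :
  is_metric d -> geodesic_space d -> CN_inequality d -> minimizes d n x b ->
  forall z, INR n * d b z ^ 2
    <= sumR n (fun i => d (x i) z ^ 2) - sumR n (fun i => d (x i) b ^ 2).
Proof.
  intros Hm Hg HCN Hb.
  assert (Hk : forall k z, (1 - (/ 2) ^ k) * (INR n * d b z ^ 2)
    <= sumR n (fun i => d (x i) z ^ 2) - sumR n (fun i => d (x i) b ^ 2)).
  { induction k as [|k IH]; intros z.
    - rewrite pow_O. specialize (Hb z). cbv beta in Hb. lra.
    - destruct (Hg b z) as [g G].
      assert (Hs : sumR n (fun i => d (x i) (g (d b z / 2)) ^ 2)
        <= sumR n (fun i => / 2 * (d (x i) b ^ 2 + d (x i) z ^ 2) - d b z ^ 2 / 4)).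
      { apply sumR_le. intros i _. specialize (HCN (x i) b z g G). lra. }
      rewrite sumR_minus, sumR_scal, sumR_plus, sumR_const in Hs.
      specialize (IH (g (d b z / 2))).
      assert (Em : d b (g (d b z / 2)) = d b z / 2).
      { destruct G as [G0 [_ Gd]]. rewrite <- G0 at 1.
        assert (0 <= d b z) by apply Hm.
        rewrite Gd by lra. rewrite Rabs_left1; lra. }
      rewrite Em in IH. rewrite <- tech_pow_Rmult. nra. }
  intros z. apply le_of_le_plus_linear with (INR n * d b z ^ 2). intros h Hh.
  destruct (pow_lt_1_zero (/ 2)) with (y := h) as [N HN]; [rewrite Rabs_right; lra|lra|].
  specialize (HN N (le_n N)). assert (Hr := Rle_abs ((/ 2) ^ N)).
  specialize (Hk N z).
  assert (0 <= INR n * d b z ^ 2) by (apply Rmult_le_pos; [apply pos_INR|apply pow2_ge_0]).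
  nra.
Qed.

Lemma CN_barycenter_lipschitz {M : Type} (d : M -> M -> R) (n : nat) (x y : nat -> M) (b b' : M) :
  is_metric d -> geodesic_space d -> CN_inequality d -> (1 <= n)%nat ->
  minimizes d n x b -> minimizes d n y b' ->
  d b b' <= 1 / INR n * sumR n (fun i => d (x i) (y i)).
Proof.
  intros Hm Hg HCN Hn Hx Hy.
  assert (Hn0 : 0 < INR n) by (apply lt_0_INR; lia).
  assert (V1 := CN_variance d n x b Hm Hg HCN Hx b').
  assert (V2 := CN_variance d n y b' Hm Hg HCN Hy b).
  assert (Q : sumR n (fun i => (d (x i) b' ^ 2 + d (y i) b ^ 2) - (d (x i) b ^ 2 + d (y i) b' ^ 2))
    <= sumR n (fun i => 2 * d b b' * d (x i) (y i))).
  { apply sumR_le. intros i _.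
    assert (H := CN_quadrilateral d Hm Hg HCN (x i) (y i) b b'). lra. }
  rewrite sumR_minus, !sumR_plus, sumR_scal in Q.
  destruct Hm as [Pos [_ [Sym _]]]. rewrite (Sym b' b) in V2.
  assert (Hl := Pos b b').
  assert (Hs : 0 <= sumR n (fun i => d (x i) (y i))).
  { rewrite <- (Rmult_0_r (INR n)), <- (sumR_const n 0). apply sumR_le. intros; apply Pos. }
  set (s := sumR n (fun i => d (x i) (y i))) in *. set (l := d b b') in *.
  apply Rmult_le_reg_l with (INR n); [easy|].
  replace (INR n * (1 / INR n * s)) with s by (field; lra).
  destruct Hl as [Hl | <-]; [|lra].
  apply Rmult_le_reg_l with l; [easy|]. nra.
Qed.

(** * Spaces of curvature at most 1 *)

(** On the unit sphere this is an equality, the law of cosines for a point on the side [q r]. By the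
    triangle inequality the last hypothesis keeps the perimeter below [2 * PI]. *)
Definition cos_comparison {M : Type} (D : M -> M -> R) : Prop :=
  forall p q r g t, geodesic_segment D q r g -> 0 <= t <= D q r -> D p q + D q r < PI ->
    sin (D q r - t) * cos (D p q) + sin t * cos (D p r) <= sin (D q r) * cos (D p (g t)).

Definition in_ball {M : Type} (D : M -> M -> R) (o : M) (rho : R) (u : M) : Prop := D o u <= rho.

Lemma in_ball_dist {M : Type} (D : M -> M -> R) (o : M) (rho : R) (u v : M) :
  is_metric D -> in_ball D o rho u -> in_ball D o rho v -> 0 <= D u v <= 2 * rho.
Proof.
  intros [Pos [_ [Sym Tri]]] Hu Hv. unfold in_ball in *.
  specialize (Tri u o v). rewrite (Sym u o) in Tri. specialize (Pos u v). lra.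
Qed.

(** The spherical counterpart of CN. The factor [sin (D q r / 2)] is cancelled, whence the separate
    case [q = r]. *)
Lemma cos_comparison_midpoint {M : Type} (D : M -> M -> R) (p q r : M) (g : R -> M) :
  is_metric D -> cos_comparison D -> geodesic_segment D q r g -> D p q + D q r < PI ->
  cos (D p q) + cos (D p r) <= 2 * (cos (D q r / 2) * cos (D p (g (D q r / 2)))).
Proof.
  intros Hm HC G Hpi. destruct Hm as [Pos [Id _]].
  assert (Hqr := Pos q r). assert (Hpq := Pos p q). destruct Hqr as [Hqr | Hqr].
  - assert (H := HC p q r g (D q r / 2) G). set (h := D q r / 2) in *.
    replace (D q r) with (2 * h) in H, Hpi, Hqr by (unfold h; field).
    rewrite sin_2a in H. replace (2 * h - h) with h in H by ring.
    assert (0 < sin h) by (apply sin_gt_0; lra).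
    apply Rmult_le_reg_l with (sin h); [easy|].
    lapply H; [intros H'; lapply H'; [|lra]|]; lra.
  - assert (q = r) by (apply Id; lra). subst r.
    destruct G as [G0 _]. rewrite <- Hqr. replace (0 / 2) with 0 by field.
    rewrite G0, cos_0. lra.
Qed.

(** Both end points have [cos (D o _) >= cos rho >= 0], and [sin l <= sin (l - t) + sin t], so the
    comparison gives [cos (D o (g t)) >= cos rho]. *)
Lemma ball_has_geodesics {M : Type} (D : M -> M -> R) (o : M) (rho : R) :
  is_metric D -> geodesic_space D -> cos_comparison D -> 0 <= rho < PI / 4 ->
  has_geodesics_in D (in_ball D o rho).
Proof.
  intros Hm Hg HC Hr u v Hu Hv. destruct (Hg u v) as [g G]. exists g. split; [easy|].
  intros t Ht. assert (Huv := in_ball_dist D o rho u v Hm Hu Hv).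
  assert (H := HC o u v g t G Ht).
  destruct Hm as [Pos [Id [Sym Tri]]]. unfold in_ball in *.
  assert (P1 := Pos o u). assert (P2 := Pos o v). assert (P3 := Pos o (g t)).
  destruct (Req_dec (D u v) 0) as [E | NE].
  { replace t with 0 by lra. destruct G as [-> _]. easy. }
  assert (Hgt : D o (g t) <= D o u + t).
  { destruct G as [G0 [_ Gd]]. assert (E := Gd 0 t). rewrite G0 in E.
    rewrite Rabs_left1 in E by lra.     specialize (Tri o u (g t)). lra. }
  set (l := D u v) in *.
  assert (Hs : sin l <= sin (l - t) + sin t).
  { replace l with (2 * (l / 2)) at 1 by field. rewrite sin_2a.
    assert (E1 := sin_plus (l / 2) (l / 2 - t)). assert (E2 := sin_minus (l / 2) (l / 2 - t)).
    replace (l / 2 + (l / 2 - t)) with (l - t) in E1 by field.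
    replace (l / 2 - (l / 2 - t)) with t in E2 by ring.
    assert (0 <= sin (l / 2)) by (apply sin_ge_0; lra).
    assert (cos (l / 2) <= cos (l / 2 - t)).
    { destruct (Rle_dec 0 (l / 2 - t)).
      - apply cos_le_decr; lra.
      - rewrite <- (cos_neg (l / 2 - t)). apply cos_le_decr; lra. }
    nra. }
  assert (0 < sin l) by (apply sin_gt_0; lra).
  assert (0 <= sin t) by (apply sin_ge_0; lra).
  assert (0 <= sin (l - t)) by (apply sin_ge_0; lra).
  assert (cos rho <= cos (D o u)) by (apply cos_le_decr; lra).
  assert (cos rho <= cos (D o v)) by (apply cos_le_decr; lra).
  assert (0 <= cos rho) by (apply cos_nonneg_halfpi; lra).
  apply le_of_cos_le; [lra..|].
  apply Rmult_le_reg_l with (sin l); [easy|].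
  assert (sin (l - t) * cos (D o u) + sin t * cos (D o v) <= sin l * cos (D o (g t)))
    by (apply H; lra).
  nra.
Qed.

(** As in the CN case, the midpoint [m] of [x] and [b'] is compared with [y] and [b], which yields a
    four-point inequality between cosines. The tangent inequality at the half-sum of the diagonals
    turns it into one between squares, up to errors of order [h ^ 3]. *)
Lemma sphere_mixed_diff_cell {M : Type} (D : M -> M -> R) (o : M) (rho : R) :
  is_metric D -> geodesic_space D -> cos_comparison D -> 0 <= rho < PI / 4 ->
  forall h x y b b', 0 < h <= 1 ->
    in_ball D o rho x -> in_ball D o rho y -> in_ball D o rho b -> in_ball D o rho b' ->
    D x y <= h -> D b b' <= h ->
    mixed_diff (fun u v => D u v ^ 2 / 2) x y b b' <= inv_sinc (2 * rho) * (1 + 2 * h) * h ^ 2.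
Proof.
  intros Hm Hg HC Hr h x y b b' Hh Sx Sy Sb Sb' Hxy Hbb.
  destruct (ball_has_geodesics D o rho Hm Hg HC Hr x b' Sx Sb') as [g [G Gs]].
  assert (Bnd := fun u v => in_ball_dist D o rho u v Hm).
  assert (Bxb := Bnd x b Sx Sb). assert (Bxb' := Bnd x b' Sx Sb').
  assert (Byb := Bnd y b Sy Sb). assert (Byb' := Bnd y b' Sy Sb').
  assert (Bxy := Bnd x y Sx Sy). assert (Bbb' := Bnd b b' Sb Sb').
  assert (H1 := cos_comparison_midpoint D y x b' g Hm HC G).
  assert (H2 := cos_comparison_midpoint D b x b' g Hm HC G).
  assert (Sm : in_ball D o rho (g (D x b' / 2))) by (apply Gs; lra).
  set (m := g (D x b' / 2)) in *.
  assert (Bym := Bnd y m Sy Sm). assert (Bbm := Bnd b m Sb Sm).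
  destruct Hm as [_ [_ [Sym Tri]]].
  rewrite (Sym y x) in H1. rewrite (Sym b x) in H2.
  assert (Tyb := Tri y m b). rewrite (Sym m b) in Tyb.
  assert (T1 := Tri x b' b). assert (T2 := Tri y b b').
  assert (T3 := Tri x b b'). assert (T4 := Tri y b' b).
  assert (T5 := Tri x y b). assert (T6 := Tri y x b').
  assert (T7 := Tri y x b). assert (T8 := Tri x y b').
  rewrite (Sym b' b) in T1, T4. rewrite (Sym y x) in T6, T7.
  assert (Hmid : cos (D y m) + cos (D b m) <= 2 * cos (D y b / 2)).
  { rewrite form1.
    assert (cos ((D y m + D b m) / 2) <= cos (D y b / 2)) by (apply cos_le_decr; lra).
    assert (0 <= cos ((D y m + D b m) / 2)) by (apply cos_nonneg_halfpi; lra).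
    destruct (COS_bound ((D y m - D b m) / 2)). nra. }
  assert (Hq : cos (D x y) + cos (D y b') + cos (D x b) + cos (D b b')
     <= 4 * (cos (D x b' / 2) * cos (D y b / 2))).
  { assert (0 <= cos (D x b' / 2)) by (apply cos_nonneg_halfpi; lra).
    assert (cos (D x b' / 2) * (cos (D y m) + cos (D b m))
      <= cos (D x b' / 2) * (2 * cos (D y b / 2))) by (apply Rmult_le_compat_l; lra).
    lra. }
  unfold mixed_diff. clear H1 H2 Hmid Tyb G Gs.
  set (W := inv_sinc (2 * rho)).
  assert (HW : 1 <= W) by (apply inv_sinc_ge_1; lra).
  set (A := D x b) in *. set (B := D y b') in *. set (A' := D x b') in *. set (B' := D y b) in *.
  (* Half-sums and differences of opposite sides and of diagonals: the differences are at most
     [2 * h] in absolute value, so the half-sums carry the main term. *)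
  set (sg := (A + B) / 2). set (s := A - B). set (sg' := (A' + B') / 2). set (s' := A' - B').
  replace (A' ^ 2 / 2 + B' ^ 2 / 2 - A ^ 2 / 2 - B ^ 2 / 2)
    with (sg' ^ 2 - sg ^ 2 + (s' ^ 2 / 4 - s ^ 2 / 4))
    by (unfold sg, sg', s, s'; field).
  assert (E1 : cos A + cos B = 2 * (cos sg * cos (s / 2))).
  { rewrite form1. unfold sg, s. ring. }
  assert (E2 : 4 * (cos (A' / 2) * cos (B' / 2)) = 2 * (cos sg' + cos (s' / 2))).
  { unfold sg', s'. replace ((A' + B') / 2) with (A' / 2 + B' / 2) by field.
    replace ((A' - B') / 2) with (A' / 2 - B' / 2) by field. rewrite cos_plus, cos_minus. ring. }
  assert (Cd := cos_ge_taylor2 (D x y)). assert (Cl := cos_ge_taylor2 (D b b')).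
  assert (Cs := cos_ge_taylor2 (s / 2)). assert (Cs' := cos_le_taylor4 (s' / 2)).
  assert (D x y ^ 2 <= h ^ 2) by (apply pow_incr; lra).
  assert (D b b' ^ 2 <= h ^ 2) by (apply pow_incr; lra).
  assert (Hs2 : s ^ 2 <= (2 * h) ^ 2) by (apply pow_maj_Rabs, Rabs_le; unfold s; lra).
  assert (Hs2' : s' ^ 2 <= (2 * h) ^ 2) by (apply pow_maj_Rabs, Rabs_le; unfold s'; lra).
  assert (0 <= s ^ 2) by apply pow2_ge_0. assert (0 <= s' ^ 2) by apply pow2_ge_0.
  assert (Hh2 : 0 < h ^ 2) by (apply pow_lt; lra).
  assert (Hsg : 0 <= sg <= PI / 2) by (unfold sg; lra).
  assert (Hsg' : 0 <= sg' <= 2 * rho) by (unfold sg'; lra).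
  assert (Hdif : sg' - sg <= h) by (unfold sg, sg'; lra).
  assert (HWh : h ^ 2 <= W * h ^ 2).
  { rewrite <- (Rmult_1_l (h ^ 2)) at 1. apply Rmult_le_compat_r; lra. }
  assert (HWh3 : 0 < W * h * h ^ 2) by (repeat apply Rmult_lt_0_compat; lra).
  (* If [sg' < sg], the mixed difference is at most [s' ^ 2 / 4 <= h ^ 2]. *)
  destruct (Rle_dec sg sg') as [Hle | Hgt].
  2: { assert (sg' ^ 2 <= sg ^ 2) by (apply pow_incr; lra). lra. }
  assert (Hc := sqr_convex_in_cos sg' sg). set (w := inv_sinc sg') in *.
  assert (Hw1 : 1 <= w) by (apply inv_sinc_ge_1; lra).
  assert (HwW : w <= W) by (apply inv_sinc_incr; lra).
  assert (Hwc : w * cos sg' <= 1) by (apply inv_sinc_mul_cos_le_1; lra).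
  assert (Hcl : cos sg - cos sg' <= h).
  { assert (L := cos_lipschitz sg sg'). assert (Ra := Rle_abs (cos sg - cos sg')).
    rewrite (Rabs_left1 (sg - sg')) in L by lra. lra. }
  assert (Hcp : 0 <= cos sg) by (apply cos_nonneg_halfpi; lra).
  (* This makes the contribution of [s ^ 2 / 4] cancel up to order [h ^ 3]. *)
  assert (Hwcs : w * cos sg <= 1 + W * h).
  { assert (w * (cos sg - cos sg') <= w * h) by (apply Rmult_le_compat_l; lra).
    assert (w * h <= W * h) by (apply Rmult_le_compat_r; lra). lra. }
  assert (Hmain : w * (2 * (cos sg - cos sg')) <=
     w * (cos sg * (s ^ 2 / 4) + h ^ 2 - 2 * (1 - cos (s' / 2)))).
  { apply Rmult_le_compat_l; [lra|].
    assert (cos sg * (1 - cos (s / 2)) <= cos sg * ((s / 2) ^ 2 / 2))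
      by (apply Rmult_le_compat_l; lra).
    lra. }
  assert (F1 : w * (cos sg * (s ^ 2 / 4)) <= (1 + W * h) * (s ^ 2 / 4))
    by (rewrite <- Rmult_assoc; apply Rmult_le_compat_r; lra).
  assert (F2 : w * h ^ 2 <= W * h ^ 2) by (apply Rmult_le_compat_r; lra).
  assert (F3 : s' ^ 2 / 4 - h ^ 2 * h ^ 2 / 12 <= w * (2 * (1 - cos (s' / 2)))).
  { assert (s' ^ 2 * s' ^ 2 <= (2 * h) ^ 2 * (2 * h) ^ 2) by (apply Rmult_le_compat; lra).
    assert (2 * (1 - cos (s' / 2)) <= w * (2 * (1 - cos (s' / 2)))).
    { rewrite <- (Rmult_1_l (2 * (1 - cos (s' / 2)))) at 1.
      destruct (COS_bound (s' / 2)). apply Rmult_le_compat_r; lra. }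
    lra. }
  assert (F4 : W * h * (s ^ 2 / 4) <= W * h * h ^ 2) by (apply Rmult_le_compat_l; [apply Rmult_le_pos; lra|lra]).
  assert (F5 : h ^ 2 * h ^ 2 / 12 <= W * h * h ^ 2).
  { assert (h ^ 2 * h ^ 2 <= W * h * h ^ 2); [|lra].
    apply Rmult_le_compat_r; [lra|]. replace (h ^ 2) with (h * h) by ring.
    apply Rmult_le_compat_r; lra. }
  assert (Hcc : w * (cos sg' - cos sg) <= sg ^ 2 / 2 - sg' ^ 2 / 2) by (apply Hc; lra).
  lra.
Qed.

Lemma sphere_quadrilateral {M : Type} (D : M -> M -> R) (o : M) (rho : R) :
  is_metric D -> geodesic_space D -> cos_comparison D -> 0 <= rho < PI / 4 ->
  forall x y b b',
    in_ball D o rho x -> in_ball D o rho y -> in_ball D o rho b -> in_ball D o rho b' ->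
    mixed_diff (fun u v => D u v ^ 2 / 2) x y b b' <= inv_sinc (2 * rho) * (D x y * D b b').
Proof.
  intros Hm Hg HC Hr. apply mixed_diff_le_product; auto.
  - now apply ball_has_geodesics.
  - assert (1 <= inv_sinc (2 * rho)) by (apply inv_sinc_ge_1; lra). lra.
  - intros h x y b b'. now apply sphere_mixed_diff_cell.
Qed.

(** If [b] were outside, moving it back along the geodesic from [o] to the point [g rho] on the
    boundary would bring it strictly closer to every [x i], by comparison in the triangle
    [x i, o, b]. *)
Lemma sphere_minimizer_in_ball {M : Type} (D : M -> M -> R) (o : M) (rho : R)
  (n : nat) (x : nat -> M) (b : M) :
  is_metric D -> geodesic_space D -> cos_comparison D -> 0 <= rho < PI / 4 -> (1 <= n)%nat ->
  (forall i, (i < n)%nat -> in_ball D o rho (x i)) -> minimizes D n x b -> in_ball D o rho b.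
Proof.
  intros Hm Hg HC Hr Hn Hx Hb. unfold in_ball in *.
  destruct (Rle_dec (D o b) rho) as [|Hgt]; [easy|exfalso].
  destruct Hm as [Pos [_ [Sym Tri]]].
  (* No point can be strictly closer than [b] to all the [x i]. This is applied to [o], to get
     [D o b <= 2 * rho], and then to [g rho]. *)
  assert (Hcloser : forall z, exists i, (i < n)%nat /\ D (x i) b <= D (x i) z).
  { intros z. apply NNPP. intros Hno.
    apply (Rlt_irrefl (sumR n (fun i => D (x i) b ^ 2))).
    apply Rle_lt_trans with (1 := Hb z). apply sumR_lt; [easy|].
    intros i Hi. assert (D (x i) z < D (x i) b).
    { apply Rnot_le_lt. intros Hle. apply Hno. now exists i. }
    assert (H0 := Pos (x i) z). simpl. nra. }
  assert (Hb2 : D o b <= 2 * rho).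
  { destruct (Hcloser o) as [i [Hi Hle]]. specialize (Hx i Hi).
    assert (T := Tri o (x i) b). rewrite (Sym (x i) o) in Hle. lra. }
  destruct (Hg o b) as [g G]. destruct (Hcloser (g rho)) as [i [Hi Hle]].
  specialize (Hx i Hi). assert (H := HC (x i) o b g rho G).
  assert (T := Tri o (x i) b). assert (T' := Tri (x i) o (g rho)).
  assert (Ez : D o (g rho) = rho).
  { destruct G as [G0 [_ Gd]]. rewrite <- G0 at 1. rewrite Gd by lra. rewrite Rabs_left1; lra. }
  rewrite Ez in T'. rewrite (Sym (x i) o) in *.
  assert (P1 := Pos o (x i)). assert (P2 := Pos (x i) b).
  set (be := D o b) in *. set (f := D (x i) b) in *. set (u := be - rho) in *.
  assert (Hc1 : cos (D (x i) (g rho)) <= cos f) by (apply cos_le_decr; lra).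
  assert (Hc2 : cos f <= cos u) by (apply cos_le_decr; unfold u; lra).
  assert (Hc3 : cos rho <= cos (D o (x i))) by (apply cos_le_decr; lra).
  assert (Hsu : 0 < sin u) by (apply sin_gt_0; unfold u; lra).
  assert (Hcu : 0 <= cos u) by (apply cos_nonneg_halfpi; unfold u; lra).
  assert (Hcu1 : cos u < 1) by (rewrite <- cos_0; apply cos_decreasing_1; unfold u; lra).
  assert (Hcr : 0 < cos rho) by (apply cos_gt_0; lra).
  assert (Hsr : 0 <= sin rho) by (apply sin_ge_0; lra).
  assert (Hsb : sin rho <= sin be) by (apply sin_incr_1; lra).
  assert (Eb : sin be = sin u * cos rho + cos u * sin rho).
  { rewrite <- sin_plus. f_equal. unfold u; ring. }
  assert (sin u * cos (D o (x i)) + sin rho * cos f <= sin be * cos (D (x i) (g rho)))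
    by (apply H; lra).
  assert (sin u * cos rho <= (sin be - sin rho) * cos f) by nra.
  assert (sin u * cos rho <= (sin be - sin rho) * cos u) by nra.
  rewrite Eb in *.
  assert (0 < sin u * cos rho * (1 - cos u)) by (repeat apply Rmult_lt_0_compat; lra).
  assert (0 <= cos u * sin rho * (1 - cos u)) by (repeat apply Rmult_le_pos; lra).
  lra.
Qed.

(* First-order optimality of [b], in the form of the concavity of [cos] of the distance. *)
Lemma sphere_weighted_cos_sum_le {M : Type} (D : M -> M -> R) (n : nat) (x : nat -> M) (b z : M) :
  is_metric D -> geodesic_space D -> cos_comparison D ->
  (forall i, (i < n)%nat -> D (x i) b <= PI / 2) -> D b z < PI / 2 -> minimizes D n x b ->
  sumR n (fun i => inv_sinc (D (x i) b) * cos (D (x i) z))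
   <= cos (D b z) * sumR n (fun i => inv_sinc (D (x i) b) * cos (D (x i) b)).
Proof.
  intros Hm Hg HC Hxb Hbz Hb. destruct (Hg b z) as [g G].
  destruct Hm as [Pos [Id [Sym Tri]]].
  set (w := fun i => inv_sinc (D (x i) b)).
  change (fun i => inv_sinc (D (x i) b) * cos (D (x i) z)) with (fun i => w i * cos (D (x i) z)).
  change (fun i => inv_sinc (D (x i) b) * cos (D (x i) b)) with (fun i => w i * cos (D (x i) b)).
  set (Phi := fun u => sumR n (fun i => w i * cos (D (x i) u))).
  change (Phi z <= cos (D b z) * Phi b).
  assert (Hw : forall i, (i < n)%nat -> 1 <= w i).
  { intros i Hi. apply inv_sinc_ge_1. specialize (Hxb i Hi). specialize (Pos (x i) b). lra. }
  assert (Hl := Pos b z). destruct Hl as [Hl | Hl].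
  2: { assert (b = z) by (apply Id; lra). subst z. rewrite <- Hl, cos_0. lra. }
  set (l := D b z) in *.
  set (K := sumR n (fun i => (1 + w i) / 2)).
  assert (HK : 0 <= K).
  { rewrite <- (Rmult_0_r (INR n)), <- (sumR_const n 0). apply sumR_le.
    intros i Hi. specialize (Hw i Hi). lra. }
  assert (HPhi : 0 <= Phi b).
  { rewrite <- (Rmult_0_r (INR n)), <- (sumR_const n 0). apply sumR_le.
    intros i Hi. specialize (Hw i Hi). apply Rmult_le_pos; [lra|].
    apply cos_nonneg_halfpi. split; [apply Pos|now apply Hxb]. }
  assert (Hgt : forall t, 0 <= t <= l -> D b (g t) = t).
  { intros t Ht. destruct G as [G0 [_ Gd]]. rewrite <- G0 at 1.
    fold l in Gd. rewrite Gd by lra. rewrite Rabs_left1; lra. }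
  (* Minimality of [b], with squares replaced by cosines at a cost quadratic in [t]: along the
     geodesic [Phi] grows at most to second order. *)
  assert (Hup : forall t, 0 <= t <= l -> Phi (g t) <= Phi b + K * t ^ 2).
  { intros t Ht. specialize (Hb (g t)).
    assert (Hs : sumR n (fun i => D (x i) (g t) ^ 2 - D (x i) b ^ 2) <=
       sumR n (fun i => 2 * (w i * cos (D (x i) b) - w i * cos (D (x i) (g t)))
                        + (2 * t ^ 2) * ((1 + w i) / 2))).
    { apply sumR_le. intros i Hi.
      assert (Hq := sqr_le_taylor_in_cos (D (x i) b) (D (x i) (g t))). fold (w i) in Hq.
      specialize (Hxb i Hi). specialize (Hw i Hi).
      assert ((D (x i) (g t) - D (x i) b) ^ 2 <= t ^ 2).
      { apply pow_maj_Rabs, Rabs_le. assert (T1 := Tri (x i) b (g t)).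
        assert (T2 := Tri (x i) (g t) b). rewrite (Sym (g t) b) in T2.
        rewrite Hgt in T1, T2 by lra. lra. }
      assert (Hp := Pos (x i) b).
      assert ((1 + w i) / 2 * (D (x i) (g t) - D (x i) b) ^ 2 <= (1 + w i) / 2 * t ^ 2)
        by (apply Rmult_le_compat_l; lra).
      lra. }
    rewrite sumR_plus, !sumR_minus, !sumR_scal, sumR_minus in Hs.
    fold (Phi b) (Phi (g t)) K in Hs. lra. }
  (* The weighted sum of the comparison inequalities bounds [Phi] from below; the first-order terms
     in [t] then give the claim. *)
  assert (Hlow : forall t, 0 <= t <= l ->
     sin (l - t) * Phi b + sin t * Phi z <= sin l * Phi (g t)).
  { intros t Ht. unfold Phi. rewrite <- !sumR_scal, <- sumR_plus. apply sumR_le.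
    intros i Hi. specialize (Hxb i Hi). specialize (Hw i Hi).
    assert (H := HC (x i) b z g t G Ht). fold l in H.
    assert (sin (l - t) * cos (D (x i) b) + sin t * cos (D (x i) z)
            <= sin l * cos (D (x i) (g t))) by (apply H; lra).
    nra. }
  apply le_of_le_plus_linear with (2 * (Phi b / 2 + K)). intros h Hh.
  (* Since [l < PI / 2 <= 1.6], this ensures both [t <= l] and [t <= h]. *)
  set (t := h * l / 2).
  assert (Ht0 : 0 < t) by (unfold t; nra). assert (Htl : t <= l) by (unfold t; nra).
  assert (Htl' : t <= h) by (assert (Hp := PI_le_3_2); unfold t; nra).
  specialize (Hup t). specialize (Hlow t). rewrite sin_minus in Hlow.
  assert (Hsl : 0 < sin l) by (apply sin_gt_0; lra).
  assert (Hsl1 := SIN_bound l).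
  assert (Hst : t / 2 <= sin t).
  { assert (S3 := sin_ge_taylor3 t). assert (t ^ 2 <= 1 ^ 2) by (apply pow_incr; lra).
    assert (t * t ^ 2 <= t * 1) by nra. lra. }
  assert (Hct := cos_ge_taylor2 t).
  assert (E : sin t * (Phi z - cos l * Phi b) <= sin l * ((Phi b / 2 + K) * t ^ 2)).
  { assert (sin l * Phi (g t) <= sin l * (Phi b + K * t ^ 2)) by (apply Rmult_le_compat_l; lra).
    assert ((sin l * Phi b) * (1 - cos t) <= (sin l * Phi b) * (t ^ 2 / 2))
      by (apply Rmult_le_compat_l; [apply Rmult_le_pos; lra|lra]).
    lra. }
  assert (E' : sin l * ((Phi b / 2 + K) * t ^ 2) <= 1 * ((Phi b / 2 + K) * t ^ 2)).
  { apply Rmult_le_compat_r; [|lra]. apply Rmult_le_pos; [lra|apply pow2_ge_0]. }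
  set (eta := Phi z - cos l * Phi b) in *. set (Q := Phi b / 2 + K) in *.
  assert (HQ : 0 <= Q) by (unfold Q; lra).
  enough (eta <= 2 * Q * h) by (unfold eta in *; lra).
  destruct (Rle_dec eta 0) as [Hn | Hn].
  { assert (0 <= Q * h) by nra. lra. }
  assert (t / 2 * eta <= t / 2 * (2 * Q * t)) by nra.
  assert (eta <= 2 * Q * t) by (apply Rmult_le_reg_l with (t / 2); lra).
  assert (Q * t <= Q * h) by (apply Rmult_le_compat_l; lra). lra.
Qed.

(** Optimality is used twice: towards [o] it gives [Pb >= n cos rho], and towards [z] it gives
    [Pb - Pz >= (1 - cos (D b z)) * Pb]. Convexity of the square in the cosine then passes to
    squared distances. *)
Lemma sphere_variance {M : Type} (D : M -> M -> R) (o : M) (rho : R)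
  (n : nat) (x : nat -> M) (b z : M) :
  is_metric D -> geodesic_space D -> cos_comparison D -> 0 <= rho < PI / 4 ->
  (forall i, (i < n)%nat -> in_ball D o rho (x i)) ->
  in_ball D o rho b -> in_ball D o rho z -> minimizes D n x b ->
  INR n * (cos rho * (1 - cos (D b z)))
    <= sumR n (fun i => D (x i) z ^ 2 / 2) - sumR n (fun i => D (x i) b ^ 2 / 2).
Proof.
  intros Hm Hg HC Hr Hx Sb Sz Hb.
  assert (Bnd := fun u v => in_ball_dist D o rho u v Hm).
  assert (So : in_ball D o rho o).
  { unfold in_ball. destruct Hm as [_ [Id _]]. rewrite (proj2 (Id o o) eq_refl). lra. }
  assert (Hxb : forall i, (i < n)%nat -> D (x i) b <= PI / 2).
  { intros i Hi. specialize (Bnd (x i) b (Hx i Hi) Sb). lra. }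
  assert (Bbo := Bnd b o Sb So). assert (Bbz := Bnd b z Sb Sz).
  assert (Wo := sphere_weighted_cos_sum_le D n x b o Hm Hg HC Hxb).
  assert (Wz := sphere_weighted_cos_sum_le D n x b z Hm Hg HC Hxb).
  set (Pb := sumR n (fun i => inv_sinc (D (x i) b) * cos (D (x i) b))) in *.
  set (Pz := sumR n (fun i => inv_sinc (D (x i) b) * cos (D (x i) z))) in *.
  assert (Hw : forall i, (i < n)%nat -> 1 <= inv_sinc (D (x i) b)).
  { intros i Hi. specialize (Bnd (x i) b (Hx i Hi) Sb). apply inv_sinc_ge_1; lra. }
  assert (Hcr : 0 <= cos rho) by (apply cos_nonneg_halfpi; lra).
  assert (Ho : INR n * cos rho <= sumR n (fun i => inv_sinc (D (x i) b) * cos (D (x i) o))).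
  { rewrite <- sumR_const. apply sumR_le. intros i Hi. specialize (Hw i Hi).
    assert (D (x i) o <= rho) by (destruct Hm as [_ [_ [Sym _]]]; rewrite Sym; apply Hx, Hi).
    assert (0 <= D (x i) o) by apply Hm.
    assert (cos rho <= cos (D (x i) o)) by (apply cos_le_decr; lra). nra. }
  assert (0 <= Pb).
  { rewrite <- (Rmult_0_r (INR n)), <- (sumR_const n 0). apply sumR_le.
    intros i Hi. specialize (Hw i Hi). specialize (Hxb i Hi). apply Rmult_le_pos; [lra|].
    apply cos_nonneg_halfpi. split; [apply Hm|lra]. }
  assert (HPb : INR n * cos rho <= Pb).
  { assert (cos (D b o) * Pb <= 1 * Pb)
      by (apply Rmult_le_compat_r; [easy|apply COS_bound]).
    apply Rle_trans with (1 := Ho). apply Rle_trans with (cos (D b o) * Pb); [apply Wo; auto; lra|lra]. }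
  rewrite <- sumR_minus.
  apply Rle_trans with (sumR n (fun i => inv_sinc (D (x i) b) * cos (D (x i) b)
                                         - inv_sinc (D (x i) b) * cos (D (x i) z))).
  - rewrite sumR_minus. fold Pb Pz. assert (Pz <= cos (D b z) * Pb) by (apply Wz; auto; lra).
    destruct (COS_bound (D b z)). nra.
  - apply sumR_le. intros i Hi.
    assert (B1 := Bnd (x i) b (Hx i Hi) Sb). assert (B2 := Bnd (x i) z (Hx i Hi) Sz).
    assert (S := sqr_convex_in_cos (D (x i) b) (D (x i) z)). lra.
Qed.

(** Adding the two variance inequalities gives [2 n cos rho (1 - cos l) <= W l s]. Taylor bounds in
    terms of [q] and [c] replace the trigonometric functions, so that the constant is the polynomial
    [c ^ 2 * q ^ 3] in [rho]. *)
Lemma sphere_barycenter_lipschitz {M : Type} (D : M -> M -> R) (o : M) (rho : R)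
  (n : nat) (x y : nat -> M) (b b' : M) :
  is_metric D -> geodesic_space D -> cos_comparison D -> 0 <= rho < PI / 4 -> (1 <= n)%nat ->
  (forall i, (i < n)%nat -> in_ball D o rho (x i) /\ in_ball D o rho (y i)) ->
  minimizes D n x b -> minimizes D n y b' ->
  INR n * ((1 - rho ^ 2 / 2) ^ 2 * (1 - rho ^ 2 / 6) ^ 3) * D b b'
    <= sumR n (fun i => D (x i) (y i)).
Proof.
  intros Hm Hg HC Hr Hn Hxy Hb Hb'.
  assert (Hx : forall i, (i < n)%nat -> in_ball D o rho (x i)) by (intros; now apply Hxy).
  assert (Hy : forall i, (i < n)%nat -> in_ball D o rho (y i)) by (intros; now apply Hxy).
  assert (Sb := sphere_minimizer_in_ball D o rho n x b Hm Hg HC Hr Hn Hx Hb).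
  assert (Sb' := sphere_minimizer_in_ball D o rho n y b' Hm Hg HC Hr Hn Hy Hb').
  assert (V := sphere_variance D o rho n x b b' Hm Hg HC Hr Hx Sb Sb' Hb).
  assert (V' := sphere_variance D o rho n y b' b Hm Hg HC Hr Hy Sb' Sb Hb').
  set (W := inv_sinc (2 * rho)).
  assert (Q : sumR n (fun i => (D (x i) b' ^ 2 / 2 + D (y i) b ^ 2 / 2)
                               - (D (x i) b ^ 2 / 2 + D (y i) b' ^ 2 / 2))
    <= sumR n (fun i => W * D b b' * D (x i) (y i))).
  { apply sumR_le. intros i Hi.
    assert (H := sphere_quadrilateral D o rho Hm Hg HC Hr (x i) (y i) b b' (Hx i Hi) (Hy i Hi) Sb Sb').
    unfold mixed_diff in H. fold W in H. lra. }
  rewrite sumR_minus, !sumR_plus, sumR_scal in Q.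
  assert (Hl := in_ball_dist D o rho b b' Hm Sb Sb').
  destruct Hm as [Pos [_ [Sym _]]]. rewrite (Sym b' b) in V'.
  assert (Hs : 0 <= sumR n (fun i => D (x i) (y i))).
  { rewrite <- (Rmult_0_r (INR n)), <- (sumR_const n 0). apply sumR_le. intros; apply Pos. }
  set (s := sumR n (fun i => D (x i) (y i))) in *. set (l := D b b') in *.
  set (q := 1 - rho ^ 2 / 6). set (c := 1 - rho ^ 2 / 2).
  destruct (Req_dec l 0) as [-> | Hl0]; [lra|].
  assert (Hrho : 0 < rho) by lra. assert (Hpi := PI_le_3_2).
  assert (Hr2 : rho ^ 2 <= 0.8 ^ 2) by (apply pow_incr; lra).
  assert (Hq : 0 < q) by (unfold q; lra). assert (Hc : 0 < c) by (unfold c; lra).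
  assert (Hcc : c <= cos rho) by apply cos_ge_taylor2.
  (* Here [W = rho / (sin rho * cos rho)] and [sin rho >= rho * q]. *)
  assert (HWq : W * q * cos rho <= 1).
  { assert (E := inv_sinc_sin (2 * rho)). fold W in E. rewrite sin_2a in E.
    assert (S := sin_ge_taylor3 rho).
    assert (HW : 1 <= W) by (apply inv_sinc_ge_1; lra).
    apply Rmult_le_reg_l with rho; [easy|].
    assert (rho * q <= sin rho) by (unfold q; lra).
    assert (W * cos rho * (rho * q) <= W * cos rho * sin rho)
      by (apply Rmult_le_compat_l; [apply Rmult_le_pos|]; lra).
    lra. }
  (* The left side comes from [1 - cos l = 2 * sin (l / 2) ^ 2] and [l / 2 <= rho]. *)
  assert (Hcl : l ^ 2 / 2 * q ^ 2 <= 1 - cos l).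
  { replace (cos l) with (cos (2 * (l / 2))) by (f_equal; field).
    rewrite cos_2a_sin.
    assert (S := sin_ge_taylor3 (l / 2)).
    assert (Hq' : l / 2 * q <= sin (l / 2)).
    { apply Rle_trans with (l / 2 - (l / 2) ^ 3 / 6); [|lra].
      assert ((l / 2) ^ 2 <= rho ^ 2) by (apply pow_incr; lra). unfold q. nra. }
    assert (0 <= l / 2 * q) by nra.
    assert ((l / 2 * q) ^ 2 <= sin (l / 2) ^ 2) by (apply pow_incr; lra). nra. }
  assert (Hn0 : 0 < INR n) by (apply lt_0_INR; lia).
  assert (M1 : INR n * (cos rho * (l ^ 2 * q ^ 2)) <= W * l * s).
  { assert (INR n * (cos rho * (l ^ 2 / 2 * q ^ 2)) <= INR n * (cos rho * (1 - cos l))).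
    { apply Rmult_le_compat_l; [lra|]. apply Rmult_le_compat_l; lra. }
    lra. }
  assert (M2 : INR n * (cos rho * (l * q ^ 2)) <= W * s).
  { apply Rmult_le_reg_l with l; [lra|]. lra. }
  apply Rle_trans with (q * cos rho * (INR n * (cos rho * (l * q ^ 2)))).
  - replace (q * cos rho * (INR n * (cos rho * (l * q ^ 2))))
      with ((INR n * q ^ 3 * l) * cos rho ^ 2) by ring.
    replace (INR n * (c ^ 2 * q ^ 3) * l) with ((INR n * q ^ 3 * l) * c ^ 2) by ring.
    apply Rmult_le_compat_l.
    + apply Rmult_le_pos; [apply Rmult_le_pos; [lra|apply pow_le; lra]|lra].
    + apply pow_incr; lra.
  - apply Rle_trans with (q * cos rho * (W * s)).
    + apply Rmult_le_compat_l; [apply Rmult_le_pos|]; lra.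
    + replace (q * cos rho * (W * s)) with (W * q * cos rho * s) by ring.
      rewrite <- (Rmult_1_l s) at 2. apply Rmult_le_compat_r; lra.
Qed.

(** * Comparison in the model planes *)

(** The instance of the comparison condition that is used: a vertex against a point of the opposite
    side. The vertex counts as the point at parameter 0 of the side [p q], which is why
    [dk k P P = 0] is required. *)
Lemma CAT_vertex_side (k : R) (M : Type) (d : M -> M -> R) (p q r : M) (g : R -> M) (t : R)
  (P Q Rr X : pt3) :
  CAT k M d -> geodesic_segment d q r g -> 0 <= t <= d q r ->
  below_2Dk k (d p q + d q r + d r p) ->
  on_model k P -> on_model k Q -> on_model k Rr -> on_model k X ->
  dk k P Q = d p q -> dk k Q Rr = d q r -> dk k Rr P = d r p -> dk k P P = 0 ->
  dk k Q X = t -> dk k X Rr = d q r - t -> d p (g t) <= dk k P X.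
Proof.
  intros [Hm [_ [Hg HC]]] G Ht Hb MP MQ MR MX E1 E2 E3 EP EQ ER.
  destruct (Hg p q) as [g1 G1]. destruct (Hg r p) as [g3 G3].
  assert (0 <= d p q) by apply Hm.
  apply (HC p q r g1 g g3 P Q Rr G1 G G3 Hb MP MQ MR E1 E2 E3).
  - left. exists 0. split; [lra|]. split; [symmetry; apply G1|]. rewrite Rminus_0_r. auto.
  - right; left. exists t. auto.
Qed.

(** * Rescaling the metric *)

Lemma is_metric_scale {M : Type} (d : M -> M -> R) (c : R) :
  0 < c -> is_metric d -> is_metric (fun x y => c * d x y).
Proof.
  intros Hc [Pos [Id [Sym Tri]]]. repeat split.
  - intros x y. apply Rmult_le_pos; [lra|apply Pos].
  - intros E. apply Id. destruct (Rmult_integral _ _ E); lra.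
  - intros E. apply Id in E. rewrite E. ring.
  - intros x y. now rewrite Sym.
  - intros x y z. specialize (Tri x y z). nra.
Qed.

Lemma geodesic_segment_scale {M : Type} (d : M -> M -> R) (c : R) (x y : M) (g : R -> M) :
  0 < c -> geodesic_segment d x y g ->
  geodesic_segment (fun u v => c * d u v) x y (fun t => g (t / c)).
Proof.
  intros Hc [G0 [G1 Gd]].
  assert (Hcl : forall t, 0 <= t <= c * d x y -> 0 <= t / c <= d x y).
  { intros t Ht. split.
    - apply Rmult_le_reg_l with c; [easy|]. replace (c * (t / c)) with t by (field; lra). lra.
    - apply Rmult_le_reg_l with c; [easy|]. replace (c * (t / c)) with t by (field; lra). lra. }
  split; [|split].
  - replace (0 / c) with 0 by (field; lra). exact G0.
  - replace (c * d x y / c) with (d x y) by (field; lra). exact G1.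
  - intros s t Hs Ht. rewrite Gd by auto.
    replace (s / c - t / c) with (/ c * (s - t)) by (field; lra).
    rewrite Rabs_mult, (Rabs_right (/ c)) by (left; now apply Rinv_0_lt_compat). field; lra.
Qed.

Lemma geodesic_segment_unscale {M : Type} (d : M -> M -> R) (c : R) (x y : M) (g : R -> M) :
  0 < c -> geodesic_segment (fun u v => c * d u v) x y g ->
  geodesic_segment d x y (fun t => g (t * c)).
Proof.
  intros Hc [G0 [G1 Gd]]. split; [|split].
  - now rewrite Rmult_0_l.
  - now rewrite Rmult_comm.
  - intros s t Hs Ht.
    assert (E : c * d (g (s * c)) (g (t * c)) = c * Rabs (s - t)).
    { rewrite Gd by nra. replace (s * c - t * c) with (c * (s - t)) by ring.
      rewrite Rabs_mult, (Rabs_right c) by lra. ring. }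
    apply Rmult_eq_reg_l in E; [easy|lra].
Qed.

(** * Positive curvature: triangles on the sphere *)

Lemma on_model_sphere (k u v z : R) :
  0 < k -> u * u + v * v + z * z = 1 -> on_model k (u / sqrt k, v / sqrt k, z / sqrt k).
Proof.
  intros Hk E. right; left. split; [easy|]. simpl.
  assert (Hs : 0 < sqrt k) by now apply sqrt_lt_R0.
  rewrite <- E. rewrite <- (sqrt_sqrt k) at 7 by lra. field; lra.
Qed.

Lemma dk_sphere (k u v z u' v' z' : R) :
  0 < k -> dk k (u / sqrt k, v / sqrt k, z / sqrt k) (u' / sqrt k, v' / sqrt k, z' / sqrt k)
           = acos (u * u' + v * v' + z * z') / sqrt k.
Proof.
  intros Hk. unfold dk. destruct (Req_EM_T k 0); [lra|]. destruct (Rlt_dec 0 k); [|lra].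
  assert (Hs : 0 < sqrt k) by now apply sqrt_lt_R0.
  f_equal. f_equal. simpl. rewrite <- (sqrt_sqrt k) at 1 by lra. field; lra.
Qed.

Lemma acos_eq (y a : R) : 0 <= a <= PI -> y = cos a -> acos y = a.
Proof. intros Ha ->. now apply acos_cos. Qed.

(** An explicit comparison triangle, in unit vectors divided by [sqrt k]: [Q] is the pole, [Rr] and
    [X] lie on one meridian at angles [c] and [t], and [P] is at angle [a] from the pole, with [u]
    given by the law of cosines. The cosine of the angle between [P] and [X] is then
    [u * sin t + cos a * cos t]. *)
Lemma CAT_cos_comparison (k : R) (M : Type) (d : M -> M -> R) :
  0 < k -> CAT k M d -> cos_comparison (fun x y => sqrt k * d x y).
Proof.
  intros Hk HC p q r g0 t G0 Ht Hpi.
  assert (Hs : 0 < sqrt k) by now apply sqrt_lt_R0.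
  assert (G := geodesic_segment_unscale d (sqrt k) q r g0 Hs G0).
  destruct HC as [Hm HC']. assert (HC : CAT k M d) by (split; assumption). clear HC'.
  destruct Hm as [Pos [_ [Sym Tri]]].
  assert (Hpq := Pos p q). assert (Hqr := Pos q r). assert (Hrp := Pos r p).
  assert (T1 := Tri r q p). assert (T2 := Tri p r q). assert (T3 := Tri q p r).
  rewrite (Sym r q), (Sym q p) in T1. rewrite (Sym p r), (Sym r q) in T2.
  rewrite (Sym q p), (Sym p r) in T3. rewrite (Sym p r).
  assert (Hcor : exists t', 0 <= t' <= d q r /\ t = sqrt k * t' /\ g0 t = g0 (t' * sqrt k)).
  { exists (t / sqrt k). split; [|split].
    - split; (apply Rmult_le_reg_l with (sqrt k); [easy|];
        replace (sqrt k * (t / sqrt k)) with t by (field; lra)); lra.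
    - field; lra.
    - f_equal. field; lra. }
  destruct Hcor as [t' [Ht' [Et ->]]].
  set (a := sqrt k * d p q) in *. set (c := sqrt k * d q r) in *. set (b := sqrt k * d r p) in *.
  assert (Ea : a / sqrt k = d p q) by (unfold a; field; lra).
  assert (Eb : b / sqrt k = d r p) by (unfold b; field; lra).
  assert (Ec : c / sqrt k = d q r) by (unfold c; field; lra).
  assert (Ett : t / sqrt k = t') by (rewrite Et; field; lra).
  assert (Ha : 0 <= a) by (unfold a; nra). assert (Hb : 0 <= b) by (unfold b; nra).
  assert (Hc : 0 <= c) by lra.
  assert (Hbac : b <= a + c) by (unfold a, b, c; nra).
  assert (Hcab : c <= a + b) by (unfold a, b, c; nra).
  assert (Hacb : a <= c + b) by (unfold a, b, c; nra).
  destruct (Req_dec c 0) as [Hc0 | Hc0].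
  { replace t with 0 by lra. rewrite Hc0, Rminus_0_r, sin_0. lra. }
  assert (Hsc : 0 < sin c) by (apply sin_gt_0; lra).
  set (u := (cos b - cos a * cos c) / sin c).
  assert (Eu : u * sin c = cos b - cos a * cos c) by (unfold u; field; lra).
  (* The triangle inequalities, as [cos (a + c) <= cos b <= cos (a - c)], are exactly what makes the
     coordinate [v] real. *)
  assert (Hu : u * u <= sin a * sin a).
  { assert (C1 : cos (a + c) <= cos b) by (apply cos_le_decr; lra).
    assert (C2 : cos b <= cos (a - c)).
    { destruct (Rle_dec 0 (a - c)).
      - apply cos_le_decr; lra.
      - rewrite <- (cos_neg (a - c)). apply cos_le_decr; lra. }
    rewrite cos_plus in C1. rewrite cos_minus in C2.
    assert (u <= sin a) by (apply Rmult_le_reg_r with (sin c); lra).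
    assert (- sin a <= u) by (apply Rmult_le_reg_r with (sin c); lra). nra. }
  assert (Sa := sin2_cos2 a). assert (Sc := sin2_cos2 c). assert (St := sin2_cos2 t).
  unfold Rsqr in Sa, Sc, St.
  set (v := sqrt (sin a * sin a - u * u)).
  assert (Ev : v * v = sin a * sin a - u * u) by (apply sqrt_sqrt; lra).
  set (P := (u / sqrt k, v / sqrt k, cos a / sqrt k)).
  set (Q := (0 / sqrt k, 0 / sqrt k, 1 / sqrt k)).
  set (Rr := (sin c / sqrt k, 0 / sqrt k, cos c / sqrt k)).
  set (X := (sin t / sqrt k, 0 / sqrt k, cos t / sqrt k)).
  assert (H : d p (g0 (t' * sqrt k)) <= dk k P X).
  { apply (CAT_vertex_side k M d p q r (fun s => g0 (s * sqrt k)) t' P Q Rr X HC G Ht').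
    - right. rewrite <- Ea, <- Eb, <- Ec.
      apply Rmult_lt_reg_r with (sqrt k); [easy|].
      replace ((a / sqrt k + c / sqrt k + b / sqrt k) * sqrt k) with (a + c + b) by (field; lra).
      replace (2 * (PI / sqrt k) * sqrt k) with (2 * PI) by (field; lra). lra.
    - apply on_model_sphere; lra.
    - apply on_model_sphere; lra.
    - apply on_model_sphere; lra.
    - apply on_model_sphere; lra.
    - unfold P, Q. rewrite dk_sphere by easy. rewrite <- Ea. f_equal.
      apply acos_eq; [lra|]. ring.
    - unfold Q, Rr. rewrite dk_sphere by easy. rewrite <- Ec. f_equal.
      apply acos_eq; [lra|]. ring.
    - unfold Rr, P. rewrite dk_sphere by easy. rewrite <- Eb. f_equal.
      apply acos_eq; [lra|]. lra.
    - unfold P. rewrite dk_sphere by easy.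
      replace (u * u + v * v + cos a * cos a) with 1 by lra. rewrite acos_1. field; lra.
    - unfold Q, X. rewrite dk_sphere by easy. rewrite <- Ett. f_equal.
      apply acos_eq; [lra|]. ring.
    - unfold X, Rr. rewrite dk_sphere by easy. rewrite <- Ec, <- Ett.
      replace (c / sqrt k - t / sqrt k) with ((c - t) / sqrt k) by (field; lra). f_equal.
      apply acos_eq; [lra|]. rewrite cos_minus. ring. }
  unfold P, X in H. rewrite dk_sphere in H by easy.
  set (y := u * sin t + v * 0 + cos a * cos t) in *.
  (* Cauchy-Schwarz, so that [cos (acos y) = y]. *)
  assert (Hy : -1 <= y <= 1).
  { assert (y * y <= 1).
    { assert (u * u + cos a * cos a <= 1) by (assert (0 <= v * v) by apply Rle_0_sqr; lra).
      assert (0 <= (u * cos t - cos a * sin t) * (u * cos t - cos a * sin t)) by apply Rle_0_sqr.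
      unfold y.
      replace ((u * sin t + v * 0 + cos a * cos t) * (u * sin t + v * 0 + cos a * cos t)) with
       ((u * u + cos a * cos a) * (sin t * sin t + cos t * cos t)
          - (u * cos t - cos a * sin t) * (u * cos t - cos a * sin t)) by ring.
      rewrite St. lra. }
    split; nra. }
  assert (HD : sqrt k * d p (g0 (t' * sqrt k)) <= acos y).
  { apply Rmult_le_compat_l with (r := sqrt k) in H; [|lra].
    replace (sqrt k * (acos y / sqrt k)) with (acos y) in H by (field; lra). exact H. }
  assert (HD0 := Pos p (g0 (t' * sqrt k))).
  assert (Hac := acos_bound y).
  assert (Hcos : y <= cos (sqrt k * d p (g0 (t' * sqrt k)))).
  { rewrite <- (cos_acos y) at 1 by lra. apply cos_le_decr; [nra|easy|lra]. }
  apply Rmult_le_compat_l with (r := sin c) in Hcos; [|lra].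
  apply Rle_trans with (2 := Hcos). right. unfold y. rewrite sin_minus.
  replace (sin c * (u * sin t + v * 0 + cos a * cos t))
    with ((u * sin c) * sin t + sin c * cos a * cos t) by ring.
  rewrite Eu. ring.
Qed.

(** * Nonpositive curvature: triangles on the hyperboloid and in the plane *)

Lemma arcosh_cosh (x : R) : 0 <= x -> arcosh (cosh x) = x.
Proof.
  intros Hx. unfold arcosh. assert (E := cosh_sqr x).
  replace (cosh x * cosh x - 1) with (sinh x * sinh x) by lra.
  rewrite sqrt_square by now apply sinh_nonneg.
  rewrite <- (ln_exp x) at 3. f_equal. unfold cosh, sinh. field.
Qed.

Lemma arcosh_eq (y a : R) : 0 <= a -> y = cosh a -> arcosh y = a.
Proof. intros Ha ->. now apply arcosh_cosh. Qed.

Lemma arcosh_le (x y : R) : 1 <= x <= y -> arcosh x <= arcosh y.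
Proof.
  intros H. unfold arcosh. assert (H0 := sqrt_pos (x * x - 1)).
  apply ln_le; [lra|]. apply Rplus_le_compat; [lra|]. apply sqrt_le_1_alt. nra.
Qed.

Lemma on_model_hyperboloid (k u v z : R) :
  k < 0 -> 0 < z -> z * z - u * u - v * v = 1 ->
  on_model k (u / sqrt (- k), v / sqrt (- k), z / sqrt (- k)).
Proof.
  intros Hk Hz E. right; right.
  assert (Hs : 0 < sqrt (- k)) by (apply sqrt_lt_R0; lra).
  split; [easy|]. split; [|now apply Rdiv_lt_0_compat]. unfold lor3.
  replace (1 / k) with (- (z * z - u * u - v * v) / (sqrt (- k) * sqrt (- k))).
  - field; lra.
  - rewrite E, sqrt_sqrt by lra. field; lra.
Qed.

Lemma dk_hyperboloid (k u v z u' v' z' : R) :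
  k < 0 ->
  dk k (u / sqrt (- k), v / sqrt (- k), z / sqrt (- k))
       (u' / sqrt (- k), v' / sqrt (- k), z' / sqrt (- k))
    = arcosh (z * z' - u * u' - v * v') / sqrt (- k).
Proof.
  intros Hk. unfold dk. destruct (Req_EM_T k 0); [lra|]. destruct (Rlt_dec 0 k); [lra|].
  assert (Hs : 0 < sqrt (- k)) by (apply sqrt_lt_R0; lra).
  f_equal. f_equal. unfold lor3.
  replace k with (- (sqrt (- k) * sqrt (- k))) at 1 by (rewrite sqrt_sqrt; lra). field; lra.
Qed.

(** The comparison triangle is placed with the midpoint [X] of [Q] and [Rr] at the apex of the
    hyperboloid, so that the height [z] of [P] is the hyperbolic cosine of the scaled median. That
    median is then bounded by the Euclidean one. *)
Lemma CAT_neg_CN (k : R) (M : Type) (d : M -> M -> R) :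
  k < 0 -> CAT k M d -> CN_inequality d.
Proof.
  intros Hk HC p q r g G.
  destruct HC as [Hm HC']. assert (HC : CAT k M d) by (split; assumption). clear HC'.
  destruct Hm as [Pos [Id [Sym Tri]]].
  assert (Hpq := Pos p q). assert (Hqr := Pos q r). assert (Hrp := Pos r p).
  assert (T1 := Tri r q p). assert (T2 := Tri p r q). assert (T3 := Tri q p r).
  rewrite (Sym r q), (Sym q p) in T1. rewrite (Sym p r), (Sym r q) in T2.
  rewrite (Sym q p), (Sym p r) in T3. rewrite (Sym p r).
  destruct (Req_dec (d q r) 0) as [E0 | N0].
  { assert (q = r) by now apply Id. subst r. rewrite E0. replace (0 / 2) with 0 by field.
    destruct G as [-> _]. rewrite (Sym q p). lra. }
  set (s := sqrt (- k)). assert (Hs : 0 < s) by (apply sqrt_lt_R0; lra).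
  set (A := s * d p q). set (B := s * d r p). set (H := s * (d q r / 2)).
  assert (HA : 0 <= A) by (unfold A; nra). assert (HB : 0 <= B) by (unfold B; nra).
  assert (HH : 0 < H) by (unfold H; nra).
  (* In terms of the half-sum [U] and half-difference [V] of the scaled sides, the triangle
     inequalities read [V <= H <= U]. *)
  set (U := (A + B) / 2). set (V := Rabs (A - B) / 2).
  assert (HV0 : 0 <= V) by (unfold V; assert (Hp := Rabs_pos (A - B)); lra).
  assert (HVH : V <= H).
  { unfold V. enough (Rabs (A - B) <= 2 * H) by lra. apply Rabs_le. unfold A, B, H. nra. }
  assert (HHU : H <= U) by (unfold U, A, B, H; nra).
  assert (EUV : U ^ 2 + V ^ 2 = (A ^ 2 + B ^ 2) / 2).
  { unfold U, V. replace ((Rabs (A - B) / 2) ^ 2) with (Rabs (A - B) ^ 2 / 4) by field.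
    rewrite pow2_abs. field. }
  assert (Ecs : cosh A + cosh B = 2 * (cosh U * cosh V)).
  { rewrite <- cosh_plus_minus. unfold U, V, Rabs. destruct (Rcase_abs (A - B)).
    - rewrite Rplus_comm. f_equal; f_equal; field.
    - f_equal; f_equal; field. }
  assert (Ecd : (cosh A - cosh B) ^ 2 = 4 * (sinh U ^ 2 * sinh V ^ 2)).
  { replace (4 * (sinh U ^ 2 * sinh V ^ 2)) with ((2 * (sinh U * sinh V)) ^ 2) by ring.
    rewrite <- cosh_minus_plus. unfold U, V, Rabs. destruct (Rcase_abs (A - B)).
    - replace ((A + B) / 2 + - (A - B) / 2) with B by field.
      replace ((A + B) / 2 - - (A - B) / 2) with A by field. ring.
    - replace ((A + B) / 2 + (A - B) / 2) with A by field.
      replace ((A + B) / 2 - (A - B) / 2) with B by field. ring. }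
  assert (HcH := cosh_pos H). assert (HcU := cosh_pos U). assert (HcV := cosh_pos V).
  assert (HsH : 0 < sinh H) by (rewrite <- sinh_0; now apply sinh_lt).
  assert (CH := cosh_sqr H). assert (CU := cosh_sqr U). assert (CV := cosh_sqr V).
  set (z := (cosh A + cosh B) / (2 * cosh H)).
  set (u := (cosh A - cosh B) / (2 * sinh H)).
  assert (Ez : z * cosh H = cosh U * cosh V).
  { unfold z. rewrite Ecs. field; lra. }
  assert (Eu : u ^ 2 * sinh H ^ 2 = sinh U ^ 2 * sinh V ^ 2).
  { unfold u. replace (((cosh A - cosh B) / (2 * sinh H)) ^ 2 * sinh H ^ 2)
      with ((cosh A - cosh B) ^ 2 / 4) by (field; lra). rewrite Ecd. field. }
  assert (Hz : 0 < z) by (unfold z; apply Rdiv_lt_0_compat; [rewrite Ecs; nra|lra]).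
  (* After clearing denominators this factors into two differences of squared hyperbolic cosines,
     each nonnegative by [V <= H <= U]. *)
  assert (Hv : 0 <= z * z - 1 - u * u).
  { assert (cosh V <= cosh H) by (apply cosh_le; lra).
    assert (cosh H <= cosh U) by (apply cosh_le; lra).
    assert (Hpr : 0 <= (cosh U ^ 2 - cosh H ^ 2) * (cosh H ^ 2 - cosh V ^ 2))
      by (apply Rmult_le_pos; nra).
    assert (E : (z * z - 1 - u * u) * (cosh H ^ 2 * sinh H ^ 2)
      = (cosh U ^ 2 - cosh H ^ 2) * (cosh H ^ 2 - cosh V ^ 2)).
    { replace ((z * z - 1 - u * u) * (cosh H ^ 2 * sinh H ^ 2)) with
       ((z * cosh H) ^ 2 * sinh H ^ 2 - cosh H ^ 2 * sinh H ^ 2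
         - (u ^ 2 * sinh H ^ 2) * cosh H ^ 2) by ring.
      rewrite Ez, Eu. replace (sinh U ^ 2) with (cosh U ^ 2 - 1) by lra.
      replace (sinh V ^ 2) with (cosh V ^ 2 - 1) by lra.
      replace (sinh H ^ 2) with (cosh H ^ 2 - 1) by lra. ring. }
    apply Rmult_le_reg_r with (cosh H ^ 2 * sinh H ^ 2); [|lra].
    apply Rmult_lt_0_compat; apply pow_lt; lra. }
  set (v := sqrt (z * z - 1 - u * u)).
  assert (Ev : v * v = z * z - 1 - u * u) by now apply sqrt_sqrt.
  set (P := (u / s, v / s, z / s)). set (Q := (- sinh H / s, 0 / s, cosh H / s)).
  set (Rr := (sinh H / s, 0 / s, cosh H / s)). set (X := (0 / s, 0 / s, 1 / s)).
  assert (EzA : z * cosh H + u * sinh H = cosh A) by (unfold z, u; field; lra).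
  assert (EzB : z * cosh H - u * sinh H = cosh B) by (unfold z, u; field; lra).
  assert (EA : A / s = d p q) by (unfold A; field; lra).
  assert (EB : B / s = d r p) by (unfold B; field; lra).
  assert (EH : H / s = d q r / 2) by (unfold H; field; lra).
  assert (Hd : d p (g (d q r / 2)) <= dk k P X).
  { apply (CAT_vertex_side k M d p q r g (d q r / 2) P Q Rr X HC G); [lra|left; lra|..].
    - apply on_model_hyperboloid; lra.
    - apply on_model_hyperboloid; lra.
    - apply on_model_hyperboloid; lra.
    - apply on_model_hyperboloid; lra.
    - unfold P, Q. rewrite dk_hyperboloid by easy. fold s. rewrite <- EA. f_equal.
      apply arcosh_eq; [lra|]. lra.
    - unfold Q, Rr. rewrite dk_hyperboloid by easy. fold s.
      replace (d q r) with ((H + H) / s) by (unfold H; field; lra). f_equal.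
      apply arcosh_eq; [lra|].
      assert (E := cosh_plus_minus H H). rewrite Rminus_diag, cosh_0 in E. lra.
    - unfold Rr, P. rewrite dk_hyperboloid by easy. fold s. rewrite <- EB. f_equal.
      apply arcosh_eq; [lra|]. lra.
    - unfold P. rewrite dk_hyperboloid by easy. fold s.
      replace (z * z - u * u - v * v) with (cosh 0) by (rewrite cosh_0; lra).
      rewrite arcosh_cosh by lra. field; lra.
    - unfold Q, X. rewrite dk_hyperboloid by easy. fold s. rewrite <- EH. f_equal.
      apply arcosh_eq; [lra|]. lra.
    - unfold X, Rr. rewrite dk_hyperboloid by easy. fold s.
      replace (d q r - d q r / 2) with (H / s) by lra. f_equal.
      apply arcosh_eq; [lra|]. lra. }
  unfold P, X in Hd. rewrite dk_hyperboloid in Hd by easy. fold s in Hd.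
  replace (z * 1 - u * 0 - v * 0) with z in Hd by ring.
  (* The squared median of the Euclidean triangle with sides [A], [B] and [2 * H]. *)
  set (w := U ^ 2 + V ^ 2 - H ^ 2).
  assert (Hw : 0 <= w) by (unfold w; nra).
  assert (Ew : sqrt w ^ 2 = w) by (rewrite <- Rsqr_pow2; now apply Rsqr_sqrt).
  assert (Hzn : z <= cosh (sqrt w)).
  { apply Rmult_le_reg_r with (cosh H); [easy|]. rewrite Ez.
    apply cosh_mul_le; try lra; [apply sqrt_pos|]. rewrite Ew. unfold w. ring. }
  assert (Hz1 : 1 <= z) by nra.
  assert (Har : arcosh z <= sqrt w).
  { rewrite <- (arcosh_cosh (sqrt w)) by apply sqrt_pos. apply arcosh_le; lra. }
  assert (Hm0 := Pos p (g (d q r / 2))). set (mu := d p (g (d q r / 2))) in *.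
  assert (Hsm : s * mu <= sqrt w).
  { apply Rmult_le_compat_l with (r := s) in Hd; [|lra].
    replace (s * (arcosh z / s)) with (arcosh z) in Hd by (field; lra). lra. }
  assert (Hsq : (s * mu) ^ 2 <= sqrt w ^ 2) by (apply pow_incr; split; [nra|easy]).
  rewrite Ew in Hsq. unfold w in Hsq. rewrite EUV in Hsq.
  apply Rmult_le_reg_l with (s ^ 2); [apply pow_lt; lra|].
  unfold A, B, H in Hsq. lra.
Qed.

(** The comparison triangle has the midpoint of [q r] at the origin; the squared distance [m] from
    the origin to the third vertex is exactly the right-hand side of CN. *)
Lemma CAT_0_CN (M : Type) (d : M -> M -> R) : CAT 0 M d -> CN_inequality d.
Proof.
  intros HC p q r g G.
  destruct HC as [Hm HC']. assert (HC : CAT 0 M d) by (split; assumption). clear HC'.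
  destruct Hm as [Pos [Id [Sym Tri]]].
  assert (Hpq := Pos p q). assert (Hqr := Pos q r). assert (Hrp := Pos r p).
  assert (T1 := Tri r q p). assert (T2 := Tri p r q). assert (T3 := Tri q p r).
  rewrite (Sym r q), (Sym q p) in T1. rewrite (Sym p r), (Sym r q) in T2.
  rewrite (Sym q p), (Sym p r) in T3. rewrite (Sym p r).
  destruct (Req_dec (d q r) 0) as [E0 | N0].
  { assert (q = r) by now apply Id. subst r. rewrite E0. replace (0 / 2) with 0 by field.
    destruct G as [-> _]. rewrite (Sym q p). lra. }
  set (a := d p q) in *. set (b := d r p) in *. set (c := d q r) in *.
  set (m := (a ^ 2 + b ^ 2) / 2 - c ^ 2 / 4).
  set (u := (a ^ 2 - b ^ 2) / (2 * c)).
  assert (Eu : u * c = (a ^ 2 - b ^ 2) / 2) by (unfold u; field; lra).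
  (* Heron's formula: times [4 * c ^ 2] this is the product [((a + b) ^ 2 - c ^ 2) * (c ^ 2 - (a -
     b) ^ 2)]. *)
  assert (Hmu : 0 <= m - u ^ 2).
  { assert (0 <= ((a + b) ^ 2 - c ^ 2) * (c ^ 2 - (a - b) ^ 2)) by (apply Rmult_le_pos; nra).
    apply Rmult_le_reg_r with (4 * c ^ 2); [assert (0 < c ^ 2) by (apply pow_lt; lra); lra|].
    replace ((m - u ^ 2) * (4 * c ^ 2)) with (4 * c ^ 2 * m - 4 * (u * c) ^ 2) by ring.
    rewrite Eu. unfold m. lra. }
  set (v := sqrt (m - u ^ 2)).
  assert (Ev : v ^ 2 = m - u ^ 2) by (unfold v; rewrite <- Rsqr_pow2; now apply Rsqr_sqrt).
  assert (Hdk : forall x y x' y' e, 0 <= e -> (x - x') ^ 2 + (y - y') ^ 2 = e ^ 2 ->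
            dk 0 (x, y, 0) (x', y', 0) = e).
  { intros x y x' y' e He E. unfold dk. destruct (Req_EM_T 0 0); [|lra].
    replace ((x - x') ^ 2 + (y - y') ^ 2 + (0 - 0) ^ 2) with (e ^ 2) by (rewrite <- E; ring).
    now apply sqrt_pow2. }
  assert (Hon : forall x y, on_model 0 (x, y, 0)) by (intros x y; now left).
  assert (Hd : d p (g (c / 2)) <= dk 0 (u, v, 0) (0, 0, 0)).
  { apply (CAT_vertex_side 0 M d p q r g (c / 2) (u, v, 0) (- (c / 2), 0, 0) (c / 2, 0, 0)
             (0, 0, 0) HC G); auto; fold a b c; try apply Hdk; try lra.
    - left; lra.
    - replace ((u - - (c / 2)) ^ 2 + (v - 0) ^ 2) with (u ^ 2 + u * c + c ^ 2 / 4 + v ^ 2) by field.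
      rewrite Eu, Ev. unfold m. field.
    - replace ((c / 2 - u) ^ 2 + (0 - v) ^ 2) with (u ^ 2 - u * c + c ^ 2 / 4 + v ^ 2) by field.
      rewrite Eu, Ev. unfold m. field. }
  assert (Hm : 0 <= m) by (assert (0 <= u ^ 2) by apply pow2_ge_0; lra).
  assert (Em : sqrt m ^ 2 = m) by (rewrite <- Rsqr_pow2; now apply Rsqr_sqrt).
  rewrite (Hdk u v 0 0 (sqrt m)) in Hd; [|apply sqrt_pos|lra].
  assert (Hp := Pos p (g (c / 2))).
  assert (d p (g (c / 2)) ^ 2 <= sqrt m ^ 2) by (apply pow_incr; lra).
  rewrite Em in H. exact H.
Qed.

(** * The Lipschitz constant *)

(** The polynomial [G] decreases in [rho], and so does [e <= 1.6 - 2 * rho]. On an interval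
    [[r0, r]] it is thus enough to compare [e] at [r0] with [G] at [r]. *)
Lemma Rpower_quarter_le (rho e : R) :
  0 <= rho -> 0 < e -> e = PI / 2 - 2 * rho ->
  Rpower e (1 / 4) <= 2 * ((1 - rho ^ 2 / 2) ^ 2 * (1 - rho ^ 2 / 6) ^ 3).
Proof.
  intros Hr He Ee. assert (Hpi := PI_le_3_2).
  set (G := (1 - rho ^ 2 / 2) ^ 2 * (1 - rho ^ 2 / 6) ^ 3).
  assert (HG : forall r, 0 <= r <= 0.8 -> rho <= r ->
            0 <= (1 - r ^ 2 / 2) ^ 2 * (1 - r ^ 2 / 6) ^ 3 <= G).
  { intros r H0 Hrr. assert (rho ^ 2 <= r ^ 2) by (apply pow_incr; lra).
    assert (r ^ 2 <= 0.8 ^ 2) by (apply pow_incr; lra).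
    split; [apply Rmult_le_pos; apply pow_le; lra|].
    apply Rmult_le_compat; try (apply pow_le; lra); apply pow_incr; lra. }
  assert (Hcase : forall r0 r, 0 <= r <= 0.8 -> rho <= r -> r0 <= rho ->
     1.6 - 2 * r0 <= (2 * ((1 - r ^ 2 / 2) ^ 2 * (1 - r ^ 2 / 6) ^ 3)) ^ 4 -> e <= (2 * G) ^ 4).
  { intros r0 r H0 Hrr Hr0 Hn. specialize (HG r H0 Hrr).
    apply Rle_trans with (1.6 - 2 * r0); [clear Hn HG; lra|]. apply Rle_trans with (1 := Hn).
    generalize dependent ((1 - r ^ 2 / 2) ^ 2 * (1 - r ^ 2 / 6) ^ 3). intros g [Hg0 Hg1] _.
    apply pow_incr; lra. }
  (* The four intervals cover [[0, 0.8]], which contains [[0, PI / 4]], and shrink where the margin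
     gets thin. *)
  assert (Hmain : e <= (2 * G) ^ 4).
  { destruct (Rle_dec rho 0.5); [apply (Hcase 0 0.5); lra|].
    destruct (Rle_dec rho 0.65); [apply (Hcase 0.5 0.65); lra|].
    destruct (Rle_dec rho 0.72); [apply (Hcase 0.65 0.72); lra|].
    apply (Hcase 0.72 0.8); lra. }
  assert (HGp : 0 < 2 * G).
  { assert (H0 := HG 0.8). lra. }
  apply Rle_trans with (Rpower ((2 * G) ^ 4) (1 / 4)).
  - apply Rle_Rpower_l; lra.
  - rewrite <- Rpower_pow by easy. rewrite Rpower_mult.
    replace (INR 4 * (1 / 4)) with 1 by (simpl; field). rewrite Rpower_1 by easy. lra.
Qed.

Theorem mainTheorem3 (k : R) (M : Type) (d : M -> M -> R) (C : M -> Prop) :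
  CAT k M d -> convex_domain k d C ->
  forall (n : nat), (1 <= n)%nat ->
  forall (x y : nat -> M), (forall i, (i < n)%nat -> C (x i) /\ C (y i)) ->
  forall bx by_, is_barycenter d n x bx -> is_barycenter d n y by_ ->
  (k <= 0 ->
     d bx by_ <= 1 / INR n * sumR n (fun i => d (x i) (y i))) /\
  (0 < k -> forall (eps : R) (o : M), 0 < eps ->
     in_closed_ball d C o ((PI / sqrt k / 2 - eps) / 2) ->
     d bx by_ <= (2 / (Rpower eps (1/4) * Rpower k (1/8))) / INR n
                   * sumR n (fun i => d (x i) (y i))).
Proof.
  intros HC _ n Hn x y Hxy b b' Hb Hb'.
  apply barycenter_minimizes in Hb; [|easy]. apply barycenter_minimizes in Hb'; [|easy].
  assert (Hm : is_metric d) by apply HC. assert (Hg : geodesic_space d) by apply HC.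
  split.
  - intros Hk. apply CN_barycenter_lipschitz; auto.
    destruct Hk as [Hk | ->]; [now apply (CAT_neg_CN k)|now apply CAT_0_CN].
  - intros Hk eps o He HCo.
    assert (Hs : 0 < sqrt k) by now apply sqrt_lt_R0.
    set (D := fun u v => sqrt k * d u v).
    (* The radius of the given ball after rescaling to curvature 1; thus
       [sqrt k * eps = PI / 2 - 2 * rho]. *)
    set (rho := (PI / 2 - sqrt k * eps) / 2).
    assert (Hin : forall u, C u -> in_ball D o rho u).
    { intros u Hu. unfold in_ball, D, rho.
      replace ((PI / 2 - sqrt k * eps) / 2) with (sqrt k * ((PI / sqrt k / 2 - eps) / 2))
        by (field; lra).
      apply Rmult_le_compat_l; [lra|now apply HCo]. }
    assert (HmD : is_metric D) by now apply is_metric_scale.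
    assert (Hse : 0 < sqrt k * eps) by now apply Rmult_lt_0_compat.
    (* As [n >= 1], the point [x 0] lies in the ball. *)
    assert (Hrho : 0 <= rho).
    { apply Rle_trans with (D o (x 0%nat)); [apply HmD|]. apply Hin, Hxy. lia. }
    assert (HgD : geodesic_space D).
    { intros u v. destruct (Hg u v) as [g G]. exists (fun t => g (t / sqrt k)).
      now apply geodesic_segment_scale. }
    assert (HminD : forall z c, minimizes d n z c -> minimizes D n z c).
    { intros z c Hz w. unfold D.
      rewrite !(sumR_ext n (fun i => (sqrt k * d (z i) _) ^ 2) (fun i => sqrt k ^ 2 * d (z i) _ ^ 2))
        by (intros; apply Rpow_mult_distr).
      rewrite !sumR_scal. apply Rmult_le_compat_l; [apply pow2_ge_0|apply Hz]. }
    assert (L : INR n * ((1 - rho ^ 2 / 2) ^ 2 * (1 - rho ^ 2 / 6) ^ 3) * D b b'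
       <= sumR n (fun i => D (x i) (y i))).
    { apply (sphere_barycenter_lipschitz D o rho n x y); auto.
      - now apply CAT_cos_comparison.
      - unfold rho in *. lra.
      - intros i Hi. destruct (Hxy i Hi). auto. }
    unfold D in L. rewrite sumR_scal in L.
    set (S := sumR n (fun i => d (x i) (y i))) in *.
    set (G := (1 - rho ^ 2 / 2) ^ 2 * (1 - rho ^ 2 / 6) ^ 3) in *.
    assert (L' : INR n * G * d b b' <= S) by (apply Rmult_le_reg_l with (sqrt k); lra).
    (* The constant depends only on the scale-invariant quantity [sqrt k * eps]. *)
    assert (ER : Rpower eps (1 / 4) * Rpower k (1 / 8) = Rpower (sqrt k * eps) (1 / 4)).
    { rewrite <- Rpower_sqrt by easy.
      rewrite <- Rpower_mult_distr by (try easy; apply exp_pos).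
      rewrite Rpower_mult. rewrite Rmult_comm. f_equal. f_equal. field. }
    rewrite ER.
    assert (HG : Rpower (sqrt k * eps) (1 / 4) <= 2 * G)
      by (apply Rpower_quarter_le; [easy|easy|unfold rho; field]).
    assert (Hp : 0 < Rpower (sqrt k * eps) (1 / 4)) by apply exp_pos.
    set (p := Rpower (sqrt k * eps) (1 / 4)) in *.
    assert (Hn0 : 0 < INR n) by (apply lt_0_INR; lia).
    assert (Hl : 0 <= INR n * d b b') by (apply Rmult_le_pos; [lra|apply Hm]).
    (* What remains is [n * p * d b b' <= 2 * S], which follows from [p <= 2 * G] and [L']. *)
    apply Rmult_le_reg_l with (INR n * p); [now apply Rmult_lt_0_compat|].
    replace (INR n * p * (2 / p / INR n * S)) with (2 * S) by (field; lra).
    nra.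
Qed.
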